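(* Let $\gamma\in\mathcal{S}^2$ with $\|\gamma\|_{\mathcal{S}^2}=1$ and let $\Omega\subset\mathbb{R}^{2d}$ be measurable. The mixed-state localization operators $A_\Omega^{\gamma\gamma^*}:L^2(\mathbb{R}^d)\to L^2(\mathbb{R}^d)$ and $A_\Omega^{\gamma\gamma^*}:\mathcal{S}^2\to\mathcal{S}^2$ have the same eigenvalues. Moreover, every eigenvalue of $A_\Omega^{\gamma\gamma^*}:\mathcal{S}^2\to\mathcal{S}^2$ has infinite multiplicity, and the corresponding eigenvectors have rank one unless the corresponding eigenvalue of $A_\Omega^{\gamma\gamma^*}:L^2(\mathbb{R}^d)\to L^2(\mathbb{R}^d)$ has multiplicity greater than one. Finally, $$\sup_{\rho\in\mathcal{S}^2}\frac{\int_\Omega\|\mathfrak{V}_\gamma\rho(z)\|_{\mathcal{S}^2}^2\,dz}{\|\rho\|_{\mathcal{S}^2}^2}=\sup_{f\in L^2(\mathbb{R}^d)}\frac{\int_\Omega\|\mathfrak{V}_\gamma f(z)\|_2^2\,dz}{\|f\|_2^2},$$ and the left-hand side is maximized by a rank-one operator.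
   Context: $\mathcal{S}^2$ is the space of Hilbert–Schmidt operators on $L^2(\mathbb{R}^d)$, with norm $\|\cdot\|_{\mathcal{S}^2}$, and $\|\cdot\|_2$ is the norm of $L^2(\mathbb{R}^d)$. For $z=(x,\omega)\in\mathbb{R}^{2d}$, $(\pi(z)g)(t)=g(t-x)e^{2\pi i\omega\cdot t}$. For $\gamma,\rho\in\mathcal{S}^2$ and $f\in L^2(\mathbb{R}^d)$, $\mathfrak{V}_\gamma\rho(z)=\gamma^*\pi(z)^*\rho\in\mathcal{S}^2$ and $\mathfrak{V}_\gamma f(z)=\gamma^*\pi(z)^*f\in L^2(\mathbb{R}^d)$. The mixed-state localization operator acts on $\mathcal{S}^2$ by $A_\Omega^{\gamma\gamma^*}\rho=\int_\Omega\pi(z)\gamma\,\mathfrak{V}_\gamma\rho(z)\,dz=\int_\Omega\pi(z)\gamma\gamma^*\pi(z)^*\rho\,dz$ and on $L^2(\mathbb{R}^d)$ by $A_\Omega^{\gamma\gamma^*}f=\int_\Omega\pi(z)\gamma\gamma^*\pi(z)^*f\,dz$ (weak integrals). The quotients in the suprema are taken over nonzero $\rho$ and $f$.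
   Formalization: The maximizer claim fails for some Ω of infinite measure (half-plane, γ a Gaussian projection). It is proved if Ω has finite measure or the supremum is attained by some ρ; for all Ω the supremum equals that over rank-one operators. Measurable means Borel. *)

(* Defs.v *)
From HB Require Import structures.
From mathcomp Require Import all_boot all_order all_algebra.
From mathcomp Require Import all_classical all_reals all_analysis.
From mathcomp Require Export complex.
Import Order.TTheory GRing.Theory Num.Theory.

Set Implicit Arguments.
Unset Strict Implicit.
Unset Printing Implicit Defensive.

Local Open Scope classical_set_scope.
Local Open Scope ring_scope.
Local Open Scope complex_scope.
Local Open Scope quotient_scope.

Notation Euclid R d := (d.-tuple (measurableTypeR R)).

Section lebesgue_cons.
Context {R : realType} {n : nat}.
Variable m : {sigma_finite_measure set (Euclid R n) -> \bar R}.

Definition tcons (u : measurableTypeR R * Euclid R n) : Euclid R n.+1 :=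
  [tuple of u.1 :: u.2].

Lemma measurable_tcons : measurable_fun setT tcons.
Proof. by apply: measurable_cons; [exact: measurable_fst|exact: measurable_snd]. Qed.

(* Image of the product measure on R * R^n under (x, t) |-> x :: t. *)
Definition lebesgue_cons : set (Euclid R n.+1) -> \bar R :=
  pushforward (lebesgue_measure \x m)%E tcons.

Let lebesgue_cons0 : lebesgue_cons set0 = 0%E.
Proof. by rewrite /lebesgue_cons /pushforward preimage_set0 measure0. Qed.

Let lebesgue_cons_ge0 A : (0 <= lebesgue_cons A)%E.
Proof. by rewrite measure_ge0// => mt; exact: measurable_tcons. Qed.

Let lebesgue_cons_sigma_additive : semi_sigma_additive lebesgue_cons.
Proof. by apply: measure_semi_sigma_additive; exact: measurable_tcons. Qed.

HB.instance Definition _ := isMeasure.Build _ _ _ lebesgue_cons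
  lebesgue_cons0 lebesgue_cons_ge0 lebesgue_cons_sigma_additive.

Let lebesgue_cons_sigma_finite : sigma_finite setT lebesgue_cons.
Proof.
have /sigma_finiteP[F [TF ndF Foo]] :=
  sigma_finiteT (lebesgue_measure : {sigma_finite_measure set (measurableTypeR R) -> \bar R}).
have /sigma_finiteP[G [TG ndG Goo]] := sigma_finiteT m.
have mhead : measurable_fun setT (@thead n _ : Euclid R n.+1 -> measurableTypeR R).
  exact: measurable_tnth.
have mbehead : measurable_fun setT (fun t : Euclid R n.+1 => [tuple of behead t]).
  exact: measurable_behead.
exists (fun k => @thead n _ @^-1` F k
    `&` (fun t : Euclid R n.+1 => [tuple of behead t]) @^-1` G k).
  rewrite predeqE => t; split => // _.
  have [k _ Fk] : (\bigcup_i F i) (thead t) by rewrite -TF.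
  have [l _ Gl] : (\bigcup_i G i) [tuple of behead t] by rewrite -TG.
  exists (maxn k l) => //; split.
    by have /subsetPset := ndF _ _ (leq_maxl k l); exact.
  by have /subsetPset := ndG _ _ (leq_maxr k l); exact.
move=> k; have [mF Fk] := Foo k; have [mG Gk] := Goo k; split.
  apply: measurableI; rewrite -[X in measurable X]setTI.
    exact: mhead.
  exact: mbehead.
rewrite /lebesgue_cons /pushforward [X in product_measure1 _ _ X](_ : _ = F k `*` G k).
  by rewrite product_measure1E// lte_mul_pinfty// ge0_fin_numE.
have tbehead x (t : Euclid R n) : [tuple of behead (tcons (x, t))] = t.
  exact: val_inj.
by apply/seteqP; split=> -[x t] /=; rewrite theadE tbehead.
Qed.

HB.instance Definition _ := Measure_isSigmaFinite.Build _ _ _ lebesgue_cons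
  lebesgue_cons_sigma_finite.

End lebesgue_cons.

Fixpoint lebesgue_tuple (R : realType) (d : nat) :
    {sigma_finite_measure set (Euclid R d) -> \bar R} :=
  match d with
  | 0 => dirac [tuple]
  | n.+1 => lebesgue_cons (lebesgue_tuple R n)
  end.

Section L2.
Context {R : realType} {d : nat}.
Local Notation mu := (lebesgue_tuple R d).
Local Notation C := R[i].

Definition square_integrable : {pred Euclid R d -> C} :=
  fun f => (@complex.Re R \o f \in Lfun mu 2%:E) && (@complex.Im R \o f \in Lfun mu 2%:E).

Let square_integrable_submod : submod_closed square_integrable.
Proof.
have [L0 Llin] := @Lfun_submod_closed _ _ R mu 2%:E (lee1n 2).
split=> [|a f g /andP[f1 f2] /andP[g1 g2]]; first by apply/andP; split; exact: L0.
case: a => a b; apply/andP; split.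
  have -> : @complex.Re R \o ((a +i* b) *: f + g) =
      a *: (@complex.Re R \o f) + (- b *: (@complex.Im R \o f) + (@complex.Re R \o g)).
    apply/funext => t; rewrite !fctE /=.
    by case: (f t) (g t) => [? ?] [? ?] /=; rewrite addrA scaleNr.
  exact/Llin/Llin.
have -> : @complex.Im R \o ((a +i* b) *: f + g) =
    a *: (@complex.Im R \o f) + (b *: (@complex.Re R \o f) + (@complex.Im R \o g)).
  apply/funext => t; rewrite !fctE /=.
  by case: (f t) (g t) => [? ?] [? ?] /=; rewrite addrA.
exact/Llin/Llin.
Qed.

HB.instance Definition _ := GRing.isSubmodClosed.Build C (Euclid R d -> C)
  square_integrable square_integrable_submod.

Record sqfun := SqFun {
  sqfun_val :> Euclid R d -> C;
  _ : sqfun_val \in square_integrable }.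

HB.instance Definition _ := [isSub for sqfun_val].
HB.instance Definition _ := [Choice of sqfun by <:].
HB.instance Definition _ := [SubChoice_isSubLmodule of sqfun by <:].

Definition null_sqfun : {pred sqfun} :=
  fun f => `[< {ae mu, forall t, f t = 0} >].

Let null_sqfun_submod : submod_closed null_sqfun.
Proof.
split=> [|a f g /asboolP f0 /asboolP g0].
  by apply/asboolP; exact: aeW.
apply/asboolP; apply: filterS2 f0 g0 => t ft gt.
rewrite -[LHS]/(a * f t + g t).
by rewrite ft gt mulr0 addr0.
Qed.

HB.instance Definition _ := GRing.isSubmodClosed.Build C sqfun
  null_sqfun null_sqfun_submod.

(* Complex L^2(R^d): square-integrable functions modulo a.e. equality. *)
Definition L2 := Quotient.quot null_sqfun.

HB.instance Definition _ := Choice.on L2.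
HB.instance Definition _ := EqQuotient.on L2.
HB.instance Definition _ := GRing.Zmodule.on L2.

Definition scaleL2 (a : C) := lift_op1 L2 ( *:%R a).

Let pi_scale a : {morph \pi_L2 : f / a *: f >-> scaleL2 a f}.
Proof.
move=> f; unlock scaleL2; apply/eqP; rewrite piE Quotient.equivE.
by rewrite -scalerBr rpredZ// Quotient.idealrBE reprK.
Qed.

Canonical pi_scale_morph a := PiMorph1 (pi_scale a).

Let scaleL2A a b (f : L2) : scaleL2 a (scaleL2 b f) = scaleL2 (a * b) f.
Proof. by rewrite -[f]reprK !piE scalerA. Qed.

Let scaleL21 : left_id 1 scaleL2.
Proof. by move=> f; rewrite -[f]reprK !piE scale1r. Qed.

Let scaleL2Dr : right_distributive scaleL2 +%R.
Proof. by move=> a f g; rewrite -[f]reprK -[g]reprK !piE scalerDr. Qed.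

Let scaleL2Dl (f : L2) : {morph scaleL2^~ f : a b / a + b}.
Proof. by move=> a b; rewrite -[f]reprK !piE scalerDl. Qed.

HB.instance Definition _ := GRing.Zmodule_isLmodule.Build C L2
  scaleL2A scaleL21 scaleL2Dr scaleL2Dl.

Definition fun_of_L2 (f : L2) : Euclid R d -> C := repr f.
Coercion fun_of_L2 : L2 >-> Funclass.

End L2.

Arguments L2 R d : clear implicits.

Definition cintegral {dT} {T : measurableType dT} {R : realType}
    (mu : {measure set T -> \bar R}) (D : set T) (F : T -> R[i]) : R[i] :=
  (\int[mu]_(x in D) complex.Re (F x)) +i* (\int[mu]_(x in D) complex.Im (F x)).

Definition cintegrable {dT} {T : measurableType dT} {R : realType}
    (mu : {measure set T -> \bar R}) (D : set T) (F : T -> R[i]) :=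
  mu.-integrable D (fun x => (complex.Re (F x))%:E) /\
  mu.-integrable D (fun x => (complex.Im (F x))%:E).

(* Sum of an absolutely summable complex family, through the positive and
   negative parts of its real and imaginary parts. *)
Definition csum {I : choiceType} {R : realType} (D : set I) (F : I -> R[i]) : R[i] :=
  let rsum (a : I -> R) :=
    fine (esum D ((EFin \o a)^\+)%E) - fine (esum D ((EFin \o a)^\-)%E) in
  rsum (@complex.Re R \o F) +i* rsum (@complex.Im R \o F).

Section operators.
Context {R : realType} {d : nat}.
Local Notation C := R[i].
Local Notation L2 := (L2 R d).
Local Notation mu := (lebesgue_tuple R d).
Implicit Types (f g : L2) (T S : L2 -> L2).

Definition dotL2 f g : C := cintegral mu setT (fun t => f t * (g t)^*).
Definition normL2 f : R := Num.sqrt (complex.Re (dotL2 f f)).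

Definition bounded_linear T :=
  linear T /\ exists M : R, forall f, normL2 (T f) <= M * normL2 f.

Definition orthonormal_basis (B : set L2) :=
  (forall e f, B e -> B f -> dotL2 e f = (e == f)%:R) /\
  (forall f, (forall e, B e -> dotL2 f e = 0) -> f = 0).

(* A fixed orthonormal basis; the notions below do not depend on the choice. *)
Definition onb : set L2 := xget set0 orthonormal_basis.

Definition hs_normsq T : \bar R := \esum_(e in onb) ((normL2 (T e)) ^+ 2)%:E.

Definition hilbert_schmidt : set (L2 -> L2) :=
  [set T | bounded_linear T /\ (hs_normsq T < +oo)%E].

Definition hs_norm T : R := Num.sqrt (fine (hs_normsq T)).
Definition hs_dot T S : C := csum onb (fun e => dotL2 (T e) (S e)).

(* Every bounded operator has exactly one adjoint, so that the default value is
   irrelevant for the operators considered here. *)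
Definition adjoint T : L2 -> L2 :=
  xget (fun=> 0) [set S | forall f g, dotL2 (T f) g = dotL2 f (S g)].

(* T has a one-dimensional range. *)
Definition rank_one T := exists2 f, f != 0 & range T = [set a *: f | a in [set: C]].

Local Notation phase_space := (Euclid R d * Euclid R d)%type.
Definition lebesgue_phase : {measure set phase_space -> \bar R} := (mu \x mu)%E.

Definition expi (x : R) : C := cos x +i* sin x.

Definition tfshift_fun (z : phase_space) (g : Euclid R d -> C) : Euclid R d -> C :=
  fun t => g [tuple tnth t i - tnth z.1 i | i < d]
           * expi (2 * pi * \sum_(i < d) tnth z.2 i * tnth t i).

(* The shifted function is again square-integrable, so that [insubd] never
   returns its default value. *)
Definition tfshift (z : phase_space) (g : L2) : L2 :=
  \pi_L2 (insubd 0 (tfshift_fun z g)).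

Definition stft (gamma : L2 -> L2) (f : L2) (z : phase_space) : L2 :=
  adjoint gamma (adjoint (tfshift z) f).

Definition stft_op (gamma rho : L2 -> L2) (z : phase_space) : L2 -> L2 :=
  adjoint gamma \o adjoint (tfshift z) \o rho.

(* [weak_integral H dot D F h]: h is the (necessarily unique) weak integral of F
   over D in the Hilbert space H, a subspace of V with inner product dot. *)
Definition weak_integral (V : lmodType C) (H : set V) (dot : V -> V -> C)
    (D : set phase_space) (F : phase_space -> V) (h : V) :=
  H h /\ forall v, H v ->
    cintegrable lebesgue_phase D (fun z => dot (F z) v) /\
    dot h v = cintegral lebesgue_phase D (fun z => dot (F z) v).

(* The localization operators are given by their graphs: [locop_L2 gamma D f h]
   says that h is the image of f, and similarly for [locop_HS]. *)
Definition locop_L2 (gamma : L2 -> L2) (D : set phase_space) (f h : L2) :=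
  weak_integral setT dotL2 D (fun z => tfshift z (gamma (stft gamma f z))) h.

Definition locop_HS (gamma : L2 -> L2) (D : set phase_space) (rho T : L2 -> L2) :=
  weak_integral hilbert_schmidt hs_dot D
    (fun z => tfshift z \o gamma \o stft_op gamma rho z) T.

Definition quotient_HS (gamma : L2 -> L2) (D : set phase_space) (rho : L2 -> L2) : \bar R :=
  ((\int[lebesgue_phase]_(z in D) ((hs_norm (stft_op gamma rho z)) ^+ 2)%:E)
   / ((hs_norm rho) ^+ 2)%:E)%E.

Definition quotient_L2 (gamma : L2 -> L2) (D : set phase_space) (f : L2) : \bar R :=
  ((\int[lebesgue_phase]_(z in D) ((normL2 (stft gamma f z)) ^+ 2)%:E)
   / ((normL2 f) ^+ 2)%:E)%E.

Definition sup_quotient_HS (gamma : L2 -> L2) (D : set phase_space) : \bar R :=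
  ereal_sup [set quotient_HS gamma D rho
            | rho in [set rho | hilbert_schmidt rho /\ rho != 0]].

Definition sup_quotient_L2 (gamma : L2 -> L2) (D : set phase_space) : \bar R :=
  ereal_sup [set quotient_L2 gamma D f | f in [set f | f != 0]].

End operators.

Section eigen.
Context {C : fieldType} {V : lmodType C}.
Implicit Types (E H : set V) (A : V -> V -> Prop).

(* Eigenvectors of an operator on the subspace H given by its graph A. *)
Definition op_eigenspace H A (a : C) : set V := [set v | H v /\ A v (a *: v)].

Definition op_eigenvector H A (a : C) (v : V) := v != 0 /\ op_eigenspace H A a v.

Definition op_eigenvalue H A (a : C) := exists v, op_eigenvector H A a v.

Definition dim_ge E (n : nat) := exists v : 'I_n -> V,
  (forall i, E (v i)) /\
  (forall c : 'I_n -> C, \sum_(i < n) c i *: v i = 0 -> forall i, c i = 0).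

End eigen.

(* Main.v *)
Require Import Defs.
From mathcomp Require Import all_boot all_order all_algebra.
From mathcomp Require Import finmap.
From mathcomp Require Import all_classical all_reals all_analysis.
From mathcomp Require Import measurable_realfun complex ring lra.
Import Order.TTheory GRing.Theory Num.Theory numFieldNormedType.Exports.

Set Implicit Arguments.
Unset Strict Implicit.
Unset Printing Implicit Defensive.

Local Open Scope classical_set_scope.
Local Open Scope ring_scope.
Local Open Scope complex_scope.
Local Open Scope quotient_scope.

(** The localization operator on Hilbert-Schmidt operators composes on the left
    with the same operators A(z) = pi(z) gamma gamma^* pi(z)^* as the one on
    functions. In terms of the isomorphism between Hilbert-Schmidt operators and a
    Hilbert tensor product, it is therefore the localization operator on functions
    tensored with the identity of an infinite-dimensional space, and everything
    follows from this.

    Eigenvalues. Since A(z) (f (x) phi) = (A(z) f) (x) phi, and since pairing a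
    Hilbert-Schmidt operator T with u (x) phi gives the scalar product of T phi and
    u, an eigenvector f on functions yields the eigenvectors f (x) phi for all phi
    ([locop_rank1]), and an eigenvector rho on operators yields the eigenvectors
    rho phi on functions ([locop_apply]). The first fact gives infinite
    multiplicity, because the indicators of disjoint cubes form an infinite
    orthonormal family. By the second fact the range of rho lies in the eigenspace
    on functions, so rho has rank one if this eigenspace is a line.

    Suprema. The numerator for rho is the sum over an orthonormal basis of the
    numerators for the functions rho e ([energy_HS]), and |rho|^2 is the sum of
    the |rho e|^2; so the quotient of rho is at most the supremum on functions.
    Conversely f (x) phi with |phi| = 1 has the same quotient as f. Exchanging the
    sum with the integral requires the measurability of |gamma^* pi(z)^* f|^2 in z.
    By Parseval this is a countable sum of squared short-time Fourier transforms
    of f with windows gamma e, and these are measurable by Tonelli's theorem.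

    Maximizers. It is enough to find a maximizer f on functions. If Omega has finite
    measure, the numerator is a quadratic form whose trace is at most the measure
    of Omega times |gamma|^2, and such a form attains its supremum
    ([maximizer_exists]). If the supremum s is attained at some rho and is finite,
    then equality holds term by term in the sum over the basis, and some nonzero
    rho e is a maximizer. If s is infinite, the uniform boundedness principle,
    applied to an exhaustion of phase space by sets of finite measure, provides an f
    with an infinite numerator ([infinite_sup_attained]).

    The underlying theory is that of an abstract complex Hilbert space: projection,
    Riesz representation, existence of adjoints and of orthonormal bases, and
    Parseval's identity, which also evaluates the trace pairing of operators.
    The space of square-integrable functions modulo null functions is such a space by
    the Riesz-Fischer theorem ([L2_hilbert]), and time-frequency shifts are
    isometries by the translation invariance of Lebesgue measure. *)

(** * Complex numbers *)
Section complex_numbers.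
Context {R : realType}.
Implicit Types z w : R[i].

Definition abs2 z : R := complex.Re z ^+ 2 + complex.Im z ^+ 2.

Lemma cReD z w : complex.Re (z + w) = complex.Re z + complex.Re w.
Proof. by case: z w => [a b] [c e]. Qed.

Lemma cImD z w : complex.Im (z + w) = complex.Im z + complex.Im w.
Proof. by case: z w => [a b] [c e]. Qed.

Lemma cReN z : complex.Re (- z) = - complex.Re z.
Proof. by case: z. Qed.

Lemma cReMr (x : R) z : complex.Re (x%:C * z) = x * complex.Re z.
Proof. by case: z => [a b]; simpc. Qed.

Lemma abs2_ge0 z : 0 <= abs2 z.
Proof. by rewrite addr_ge0 ?sqr_ge0. Qed.

Lemma abs20 : abs2 0 = 0.
Proof. by rewrite /abs2 /= expr0n addr0. Qed.

Lemma abs2_eq0 z : abs2 z = 0 -> z = 0.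
Proof.
case: z => a b /eqP; rewrite paddr_eq0 ?sqr_ge0//= !sqrf_eq0.
by case/andP => /eqP -> /eqP ->.
Qed.

Lemma abs2M z w : abs2 (z * w) = abs2 z * abs2 w.
Proof. by case: z w => [a b] [c e]; rewrite /abs2 /=; ring. Qed.

Lemma abs2J z : abs2 (conjc z) = abs2 z.
Proof. by case: z => [a b]; rewrite /abs2 /= sqrrN. Qed.

Lemma abs2_real (x : R) : abs2 x%:C = x ^+ 2.
Proof. by rewrite /abs2 /= expr0n addr0. Qed.

Lemma mulcJ z : z * conjc z = (abs2 z)%:C.
Proof. by case: z => [a b]; rewrite /abs2 /=; simpc; congr (_ +i* _); ring. Qed.

Lemma complex_split z : z = complex.Re z +i* complex.Im z.
Proof. by case: z. Qed.

Lemma abs2D_le z w :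
  abs2 (z + w) <= 2 * abs2 z + 2 * abs2 w.
Proof.
case: z w => [a b] [c e]; rewrite /abs2 /= -subr_ge0.
have -> : 2 * (a ^+ 2 + b ^+ 2) + 2 * (c ^+ 2 + e ^+ 2) -
  ((a + c) ^+ 2 + (b + e) ^+ 2) = (a - c) ^+ 2 + (b - e) ^+ 2 by ring.
by rewrite addr_ge0 ?sqr_ge0.
Qed.

Lemma conjc_mul z w : conjc (z * w) = conjc z * conjc w.
Proof. by case: z w => [a b] [c e]; simpc. Qed.

End complex_numbers.

(** * Hilbert spaces *)
(** The scalar product is linear on the left. Completeness is stated for squared
    norms, so that no topology on [V] has to be declared. *)
Record hilbert_space {R : realType} {V : lmodType R[i]} (dot : V -> V -> R[i]) :
  Prop := HilbertSpace {
  hdotP : forall a u v w, dot (a *: u + v) w = a * dot u w + dot v w;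
  hdotC : forall u v, dot v u = conjc (dot u v);
  hdot_ge0 : forall u, 0 <= complex.Re (dot u u);
  hdot_eq0 : forall u, complex.Re (dot u u) = 0 -> u = 0;
  hcomplete : forall u : nat -> V,
    (forall e : R, 0 < e -> exists N, forall m n, (N <= m)%N -> (N <= n)%N ->
      complex.Re (dot (u m - u n) (u m - u n)) < e) ->
    exists l, forall e : R, 0 < e -> exists N, forall n, (N <= n)%N ->
      complex.Re (dot (u n - l) (u n - l)) < e }.

Definition sqnorm {R : realType} {V : lmodType R[i]} (dot : V -> V -> R[i]) u : R :=
  complex.Re (dot u u).

Definition hnorm {R : realType} {V : lmodType R[i]} (dot : V -> V -> R[i]) u : R :=
  Num.sqrt (sqnorm dot u).

Definition hlimit {R : realType} {V : lmodType R[i]} (dot : V -> V -> R[i])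
    (u : nat -> V) l :=
  forall e : R, 0 < e -> exists N, forall n, (N <= n)%N -> hnorm dot (u n - l) < e.

Section inner_product.
Context {R : realType} {V : lmodType R[i]} {dot : V -> V -> R[i]}.
Hypothesis H : hilbert_space dot.
Local Notation C := R[i].
Local Notation Re := (@complex.Re R).
Implicit Types (u v w f g : V) (a : C).

Local Notation sqn := (sqnorm dot).
Local Notation nrm := (hnorm dot).
Local Notation hlim := (hlimit dot).

Lemma hdotDl u v w : dot (u + v) w = dot u w + dot v w.
Proof. by rewrite -[u in LHS]scale1r hdotP// mul1r. Qed.

Lemma hdot0l w : dot 0 w = 0.
Proof. by apply: (@addrI _ (dot 0 w)); rewrite -hdotDl !addr0. Qed.

Lemma hdotZl a u w : dot (a *: u) w = a * dot u w.
Proof. by rewrite -[X in dot X]addr0 hdotP// hdot0l addr0. Qed.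

Lemma hdotNl u w : dot (- u) w = - dot u w.
Proof. by rewrite -scaleN1r hdotZl mulN1r. Qed.

Lemma hdotBl u v w : dot (u - v) w = dot u w - dot v w.
Proof. by rewrite hdotDl hdotNl. Qed.

Lemma hdot_suml I (r : seq I) (P : pred I) (F : I -> V) w :
  dot (\sum_(i <- r | P i) F i) w = \sum_(i <- r | P i) dot (F i) w.
Proof. by apply: (big_morph (dot^~ w)) => [u v|]; [exact: hdotDl|exact: hdot0l]. Qed.

Lemma hdotDr u v w : dot u (v + w) = dot u v + dot u w.
Proof. by rewrite (hdotC H) hdotDl rmorphD/= -!(hdotC H). Qed.

Lemma hdot0r w : dot w 0 = 0.
Proof. by rewrite (hdotC H) hdot0l conjc0. Qed.

Lemma hdotZr a u w : dot u (a *: w) = conjc a * dot u w.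
Proof. by rewrite (hdotC H) hdotZl rmorphM/= -!(hdotC H). Qed.

Lemma hdotNr u w : dot u (- w) = - dot u w.
Proof. by rewrite (hdotC H) hdotNl rmorphN/= -(hdotC H). Qed.

Lemma hdotBr u v w : dot u (v - w) = dot u v - dot u w.
Proof. by rewrite hdotDr hdotNr. Qed.

Lemma hdot_sumr I (r : seq I) (P : pred I) (F : I -> V) w :
  dot w (\sum_(i <- r | P i) F i) = \sum_(i <- r | P i) dot w (F i).
Proof. by apply: (big_morph (dot w)) => [u v|]; [exact: hdotDr|exact: hdot0r]. Qed.

Lemma sqn_ge0 u : 0 <= sqn u. Proof. exact: hdot_ge0. Qed.

Lemma sqn0 : sqn 0 = 0. Proof. by rewrite /sqnorm hdot0l. Qed.

Lemma sqn_gt0 u : u != 0 -> 0 < sqn u.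
Proof.
move=> u0; rewrite lt_neqAle sqn_ge0 andbT eq_sym.
by apply: contra u0 => /eqP /(hdot_eq0 H) ->.
Qed.

Lemma hdotuu u : dot u u = (sqn u)%:C.
Proof.
rewrite /sqnorm; have := hdotC H u u; case: (dot u u) => a b [] /= /eqP.
by rewrite -subr_eq0 opprK -mulr2n mulrn_eq0/= => /eqP ->.
Qed.

Lemma sqnD u v : sqn (u + v) = sqn u + sqn v + 2 * Re (dot u v).
Proof.
rewrite /sqnorm hdotDl !hdotDr !cReD (hdotC H u v).
have -> : Re (conjc (dot u v)) = Re (dot u v) by case: (dot u v).
by ring.
Qed.

Lemma sqnZ a u : sqn (a *: u) = abs2 a * sqn u.
Proof. by rewrite {1}/sqnorm hdotZl hdotZr mulrA mulcJ cReMr. Qed.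

Lemma sqnN u : sqn (- u) = sqn u.
Proof. by rewrite /sqnorm hdotNl hdotNr opprK. Qed.

Lemma sqnB u v : sqn (u - v) = sqn u + sqn v - 2 * Re (dot u v).
Proof. by rewrite sqnD sqnN hdotNr cReN mulrN. Qed.

Lemma parallelogram u v : sqn (u + v) + sqn (u - v) = 2 * sqn u + 2 * sqn v.
Proof. by rewrite sqnB sqnD; ring. Qed.

Lemma sqnD_le u v : sqn (u + v) <= 2 * sqn u + 2 * sqn v.
Proof. by rewrite -parallelogram lerDl sqn_ge0. Qed.

Lemma cauchy_schwarz u v : abs2 (dot u v) <= sqn u * sqn v.
Proof.
have [->|v0] := eqVneq v 0; first by rewrite hdot0r abs20 sqn0 mulr0.
have vp := sqn_gt0 v0.
(* The component of u orthogonal to v, multiplied by |v|^2 to avoid division. *)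
have := sqn_ge0 ((sqn v)%:C *: u - dot u v *: v).
rewrite sqnB !sqnZ abs2_real hdotZl hdotZr [conjc _ * _]mulrC mulcJ.
have -> : Re ((sqn v)%:C * (abs2 (dot u v))%:C) = sqn v * abs2 (dot u v).
  by rewrite cReMr.
move: (abs2 _) => t.
have -> : sqn v ^+ 2 * sqn u + t * sqn v - 2 * (sqn v * t) =
  sqn v * (sqn u * sqn v - t) by ring.
by rewrite pmulr_rge0// subr_ge0.
Qed.

Lemma nrm_ge0 u : 0 <= nrm u. Proof. exact: sqrtr_ge0. Qed.

Lemma sqr_nrm u : nrm u ^+ 2 = sqn u.
Proof. by rewrite sqr_sqrtr ?sqn_ge0. Qed.

Lemma nrmN u : nrm (- u) = nrm u. Proof. by rewrite /hnorm sqnN. Qed.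

Lemma nrmB u v : nrm (u - v) = nrm (v - u). Proof. by rewrite -nrmN opprB. Qed.

Lemma nrmD u v : nrm (u + v) <= nrm u + nrm v.
Proof.
rewrite -(@ler_pXn2r _ 2) ?nnegrE ?addr_ge0 ?nrm_ge0//.
rewrite sqr_nrm sqrrD !sqr_nrm sqnD.
suff : Re (dot u v) <= nrm u * nrm v by rewrite -mulr_natl; lra.
rewrite /hnorm -sqrtrM ?sqn_ge0// (le_trans (ler_norm _))// -sqrtr_sqr.
rewrite ler_sqrt ?mulr_ge0 ?sqn_ge0// (le_trans _ (cauchy_schwarz u v))//.
by rewrite lerDl sqr_ge0.
Qed.

Lemma nrm_gt0 u : u != 0 -> 0 < nrm u.
Proof. by move=> u0; rewrite sqrtr_gt0 sqn_gt0. Qed.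

Lemma nrm_lt u e : 0 <= e -> (nrm u < e) = (sqn u < e ^+ 2).
Proof. by move=> e0; rewrite -sqr_nrm ltr_pXn2r// ?nnegrE ?nrm_ge0. Qed.

Lemma hcauchy (u : nat -> V) :
  (forall e : R, 0 < e -> exists N, forall m n, (N <= m)%N -> (N <= n)%N ->
    sqn (u m - u n) < e) -> exists l, hlim u l.
Proof.
move=> /(hcomplete H)[l ul]; exists l => e e0.
have [N uN] := ul (e ^+ 2) (exprn_gt0 _ e0); exists N => n Nn.
by rewrite nrm_lt ?ltW//; exact: uN.
Qed.

End inner_product.

(** * Orthogonal projection and Riesz representation *)
(** A constant of its own, so that linear arithmetic treats 1/(n+1) as an atom. *)
Definition natSinv {R : realType} (n : nat) : R := n.+1%:R^-1.

Lemma natSinv_gt0 {R : realType} n : 0 < natSinv n :> R.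
Proof. by rewrite invr_gt0. Qed.

Lemma natSinv_lt {R : realType} (e : R) : 0 < e ->
  exists N, forall n, (N <= n)%N -> natSinv n < e.
Proof.
move=> e0; have [N _ HN] := near_infty_natSinv_lt (PosNum e0).
by exists N => n; exact: HN.
Qed.

Section projection.
Context {R : realType} {V : lmodType R[i]} {dot : V -> V -> R[i]}.
Hypothesis H : hilbert_space dot.
Local Notation C := R[i].
Local Notation Re := (@complex.Re R).
Local Notation sqn := (sqnorm dot).
Local Notation nrm := (hnorm dot).
Local Notation hlim := (hlimit dot).
Implicit Types (u v w f g : V) (a : C).

(** A sequence of [M] that minimizes the distance to [f] is Cauchy, by the
    parallelogram law. Since [M] is not assumed closed, the projection [g] is only
    a limit of elements of [M]. *)
Theorem orthogonal_projection (M : V -> Prop) :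
    M 0 -> (forall a u v, M u -> M v -> M (a *: u + v)) ->
  forall f, exists g, (forall e : R, 0 < e -> exists2 m, M m & sqn (m - g) < e) /\
    forall m, M m -> dot (f - g) m = 0.
Proof.
move=> M0 Mlin f.
pose S : set R := [set sqn (f - m) | m in M]; pose D : R := inf S.
have S0 : S !=set0 by exists (sqn (f - 0)), 0.
have Slb : has_lbound S by exists 0 => _ [m _ <-]; exact: (sqn_ge0 H).
have DS m : M m -> D <= sqn (f - m) by move=> Mm; apply: ge_inf => //; exists m.
have /choice[m_ m_P] n : exists m, M m /\ sqn (f - m) < D + natSinv n.
  have [_ [m Mm <-] mlt] := inf_adherent (natSinv_gt0 n) (conj S0 Slb).
  by exists m.
have mid m n : sqn (m_ m - m_ n) <= 2 * natSinv m + 2 * natSinv n.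
  have [[Mm lm] [Mn ln]] := (m_P m, m_P n).
  have := parallelogram H (f - m_ m) (f - m_ n).
  have -> : f - m_ m - (f - m_ n) = - (m_ m - m_ n).
    by rewrite opprB addrC addrA subrK opprB.
  rewrite (sqnN H).
  have -> : f - m_ m + (f - m_ n) = (2%:R)%:C *: (f - (2^-1)%:C *: (m_ m + m_ n)).
    rewrite scalerBr scalerA.
    have -> : (2%:R)%:C * (2^-1)%:C = 1 :> C.
      by simpc; congr (_ +i* _); field.
    have -> : (2%:R)%:C = 1 + 1 :> C by simpc.
    by rewrite scalerDl !scale1r addrACA opprD.
  rewrite (sqnZ H) abs2_real.
  have : D <= sqn (f - (2^-1)%:C *: (m_ m + m_ n)).
    apply: DS; rewrite -[_ *: _]addr0; apply: (Mlin) => //.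
    by rewrite -[m_ m]scale1r; exact: Mlin.
  by lra.
have [g mg] : exists l, hlim m_ l.
  apply: (hcauchy H) => e e0.
  have [N HN] := @natSinv_lt R (e / 4) (divr_gt0 e0 (ltr0n _ 4)).
  exists N => m n Nm Nn; rewrite (le_lt_trans (mid m n))//.
  by have := HN _ Nm; have := HN _ Nn; lra.
exists g; split=> [e e0|m Mm].
  have [N HN] := mg (Num.sqrt e) (eqbRL (sqrtr_gt0 e) e0).
  exists (m_ N); first by have [] := m_P N.
  by have := HN N (leqnn _); rewrite (nrm_lt H) ?sqrtr_ge0// sqr_sqrtr ?ltW.
pose s := sqn m; have s0 : 0 <= s := sqn_ge0 H m.
(* Moving m_ n by t d m cannot bring the distance below D; the step
   t = 1 / (|m|^2 + 1) turns this into a bound for d itself. *)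
have dn n : abs2 (dot (f - m_ n) m) <= (s + 1) * natSinv n.
  have [Mn ln] := m_P n; pose d := dot (f - m_ n) m; pose t := (s + 1)^-1.
  have : D <= sqn (f - m_ n - (t%:C * d) *: m).
    rewrite -addrA -opprD; apply: DS; rewrite addrC; exact: Mlin.
  rewrite (sqnB H) (sqnZ H) (hdotZr H) abs2M abs2_real -/s.
  have -> : Re (conjc (t%:C * d) * dot (f - m_ n) m) = t * abs2 d.
    rewrite -/d conjc_mul -mulrA [conjc _ * d]mulrC mulcJ.
    by rewrite conjc_real cReMr.
  rewrite -/d.
  have d0 := abs2_ge0 d.
  have ts : t * (s + 1) = 1 by rewrite mulVf// gt_eqF// ltr_wpDl.
  have t0 : 0 < t by rewrite invr_gt0 ltr_wpDl.
  move=> DD; rewrite mulrC -ler_pdivrMr ?ltr_wpDl// -/t mulrC.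
  have tt : t ^+ 2 * s = t - t ^+ 2 by rewrite expr2 -mulrA; nra.
  have : t ^+ 2 * abs2 d * s = t * abs2 d - t ^+ 2 * abs2 d.
    by rewrite mulrAC tt mulrBl.
  have : 0 <= t ^+ 2 * abs2 d by rewrite mulr_ge0// sqr_ge0.
  move: (t ^+ 2 * abs2 d * s) (t ^+ 2 * abs2 d) (t * abs2 d) DD => x y z.
  by lra.
apply: abs2_eq0; apply/eqP; rewrite eq_le abs2_ge0 andbT.
apply/ler_addgt0Pr => e e0; rewrite add0r.
have e4 : 0 < e / (4 * (s + 1)) by rewrite divr_gt0// mulr_gt0 ?ltr_wpDl.
have [N1 HN1] := natSinv_lt e4.
have [N2 HN2] := mg (Num.sqrt (e / (4 * (s + 1)))) (eqbRL (sqrtr_gt0 _) e4).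
pose n := maxn N1 N2.
have h1 := HN1 n (leq_maxl _ _).
have := HN2 n (leq_maxr _ _); rewrite (nrm_lt H) ?sqrtr_ge0// sqr_sqrtr ?(ltW e4)// => h2.
have -> : f - g = (f - m_ n) + (m_ n - g) by rewrite addrA subrK.
rewrite (hdotDl H) (le_trans (abs2D_le _ _))//.
have := dn n; have := cauchy_schwarz H (m_ n - g) m; rewrite -/s.
have : (s + 1) * natSinv n <= e / 4.
  rewrite mulrC -ler_pdivlMr ?ltr_wpDl// (le_trans (ltW h1))//.
  by rewrite invfM mulrA.
have : sqn (m_ n - g) * s <= e / 4.
  rewrite (@le_trans _ _ (sqn (m_ n - g) * (s + 1)))//.
    by rewrite ler_wpM2l ?(sqn_ge0 H)// lerDl.
  rewrite -ler_pdivlMr ?ltr_wpDl// (le_trans (ltW h2))//.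
  by rewrite invfM mulrA.
by lra.
Qed.

(** If [L f] is not zero, the part of [f] orthogonal to the kernel of [L] spans
    the orthogonal complement of that kernel; a multiple of it represents [L]. *)
Theorem riesz (L : V -> C) (K : R) :
    (forall a u v, L (a *: u + v) = a * L u + L v) ->
    (forall u, abs2 (L u) <= K * sqn u) ->
  exists g, forall u, L u = dot u g.
Proof.
move=> Llin LK.
have L0 : L 0 = 0.
  by have := Llin (- 1) 0 0; rewrite scaler0 addr0 mulN1r addNr.
have LZ a u : L (a *: u) = a * L u by rewrite -[_ *: _]addr0 Llin L0 addr0.
have LB u v : L (u - v) = L u - L v.
  by rewrite addrC -scaleN1r Llin mulN1r addrC.
have [[f f0]|] := pselect (exists f, L f != 0); last first.
  move=> /forallNP Lf; exists 0 => u; rewrite (hdot0r H).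
  by apply/eqP/negPn/negP; exact: Lf.
have [] := @orthogonal_projection (fun u => L u = 0) L0 _ f.
  by move=> a u v Lu Lv; rewrite Llin Lu Lv mulr0 addr0.
move=> g [gker orth].
have Lg : L g = 0.
  apply: abs2_eq0; apply/eqP; rewrite eq_le abs2_ge0 andbT.
  apply/ler_addgt0Pr => e e0; rewrite add0r.
  have K0 : 0 < `|K| + 1 by rewrite ltr_wpDl.
  have [m Lm mg] := gker (e / (`|K| + 1)) (divr_gt0 e0 K0).
  have -> : L g = - L (m - g) by rewrite LB Lm sub0r opprK.
  rewrite -mulN1r abs2M (_ : abs2 (-1) = 1) ?mul1r; last first.
    by rewrite /abs2/= oppr0 expr0n addr0 sqrrN expr1n.
  apply: (le_trans (LK _)).
  rewrite (@le_trans _ _ ((`|K| + 1) * sqn (m - g)))//.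
    rewrite ler_wpM2r ?(sqn_ge0 H)//.
    by rewrite (le_trans (ler_norm _))// lerDl.
  by rewrite mulrC -ler_pdivlMr// ltW.
pose h := f - g; have Lh : L h = L f by rewrite LB Lg subr0.
have h0 : h != 0 by apply: contra f0 => /eqP h0; rewrite -Lh h0 L0.
have hh : dot h h != 0.
  apply/eqP => hh; move: (sqn_gt0 H h0).
  by rewrite /sqnorm hh ltxx.
exists (conjc (L h / dot h h) *: h) => u.
have ker : L (u - (L u / L h) *: h) = 0.
  by rewrite LB LZ divfK ?Lh// subrr.
have := orth _ ker; rewrite -/h (hdotBr H) (hdotZr H) => /eqP.
rewrite subr_eq0 => /eqP huE.
rewrite (hdotZr H) conjcK (hdotC H h u) huE conjc_mul conjcK.
rewrite -(hdotC H h h) mulrCA divfK//.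
by rewrite divfK// Lh.
Qed.

Lemma adjoint_exists (T : V -> V) (K : R) :
    (forall a u v, T (a *: u + v) = a *: T u + T v) ->
    (forall u, sqn (T u) <= K * sqn u) ->
  exists S : V -> V, forall f g, dot (T f) g = dot f (S g).
Proof.
move=> Tlin TK.
suff /choice[S SE] : forall g, exists h, forall f, dot (T f) g = dot f h.
  by exists S => f g; exact: SE.
move=> g; apply: (@riesz _ (K * sqn g)) => [a u v|u].
  by rewrite Tlin (hdotP H).
rewrite (le_trans (cauchy_schwarz H _ _))// mulrAC ler_wpM2r ?(sqn_ge0 H)//.
Qed.

End projection.

(** * Orthonormal bases and Parseval's identity *)
Section orthonormal_bases.
Context {R : realType} {V : lmodType R[i]} {dot : V -> V -> R[i]}.
Hypothesis H : hilbert_space dot.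
Local Notation C := R[i].
Local Notation Re := (@complex.Re R).
Local Notation sqn := (sqnorm dot).
Local Notation nrm := (hnorm dot).
Local Notation hlim := (hlimit dot).
Implicit Types (u v w f g : V) (a : C).

Definition orthonormal_set (B : set V) :=
  forall e f, B e -> B f -> dot e f = (e == f)%:R.

Definition is_onb (B : set V) :=
  orthonormal_set B /\ (forall f, (forall e, B e -> dot f e = 0) -> f = 0).

(** A maximal orthonormal set, given by Zorn's lemma, is a basis: a nonzero vector
    orthogonal to it could be normalized and added. *)
Lemma onb_exists : exists B, is_onb B.
Proof.
have [F FP Ftot|A [Aon Amax]] := @Zorn_bigcup V orthonormal_set.
  move=> e f [X FX Xe] [Y FY Yf].
  have [XY|YX] := Ftot _ _ FX FY.
    by apply: (FP _ FY) => //; exact: XY.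
  by apply: (FP _ FX) => //; exact: YX.
exists A; split => // f fA; apply/eqP/negPn/negP => f0.
pose g := ((nrm f)^-1)%:C *: f.
have nf0 := nrm_gt0 H f0.
have gg : dot g g = 1.
  rewrite (hdotuu H) (sqnZ H) abs2_real -(sqr_nrm H) -exprMn mulVf ?gt_eqF//.
  by rewrite expr1n.
have gA e : A e -> dot g e = 0 by move=> Ae; rewrite (hdotZl H) fA// mulr0.
have Ag : ~ A g.
  by move=> Ag; move: (gA g Ag); rewrite gg => /eqP; rewrite oner_eq0.
apply: (Amax (A `|` [set g])).
  by split=> [e|/(_ g (or_intror erefl))//]; left.
move=> e h [Ae|->] [Ah|->].
- exact: Aon.
- rewrite (hdotC H) gA// conjc0; case: eqP => // eg.
  by move: Ag; rewrite -eg.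
- by rewrite gA//; case: eqP => // gh; move: Ag; rewrite gh.
- by rewrite gg eqxx.
Qed.

Section finite_projection.
Variables (B : set V) (s : seq V).
Hypotheses (Bon : orthonormal_set B) (us : uniq s) (sB : forall e, e \in s -> B e).

Definition hproj f := \sum_(e <- s) dot f e *: e.

Lemma dot_projl f e : e \in s -> dot (hproj f) e = dot f e.
Proof.
move=> es; rewrite (hdot_suml H) (bigD1_seq e)//= (hdotZl H).
rewrite (Bon (sB es) (sB es)) eqxx mulr1 big1_seq ?addr0// => h /andP[he hs].
by rewrite (hdotZl H) (Bon (sB hs) (sB es)) (negbTE he) mulr0.
Qed.

Lemma dot_subproj f e : e \in s -> dot (f - hproj f) e = 0.
Proof. by move=> es; rewrite (hdotBl H) dot_projl// subrr. Qed.

Lemma dot_projr f g : (forall e, e \in s -> dot f e = 0) -> dot f (hproj g) = 0.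
Proof.
move=> fs; rewrite (hdot_sumr H) big1_seq// => e /= es.
by rewrite (hdotZr H) fs// mulr0.
Qed.

Lemma sqn_proj f : sqn (hproj f) = \sum_(e <- s) abs2 (dot f e).
Proof.
rewrite /sqnorm {2}/hproj (hdot_sumr H).
rewrite (big_morph Re (id1 := 0) (op1 := +%R))//; last exact: cReD.
apply: eq_big_seq => e es.
by rewrite (hdotZr H) dot_projl// mulrC mulcJ.
Qed.

Lemma pythagoras u v : dot u v = 0 -> sqn (u + v) = sqn u + sqn v.
Proof. by move=> uv; rewrite (sqnD H) uv mulr0 addr0. Qed.

Lemma bessel_eq f :
  sqn f = sqn (f - hproj f) + \sum_(e <- s) abs2 (dot f e).
Proof.
rewrite -sqn_proj -pythagoras ?subrK//.
by apply: dot_projr => e; exact: dot_subproj.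
Qed.

Lemma bessel f : \sum_(e <- s) abs2 (dot f e) <= sqn f.
Proof. by rewrite bessel_eq lerDr (sqn_ge0 H). Qed.

End finite_projection.

Section parseval.
Variable B : set V.
Hypothesis Bonb : is_onb B.

(** The projection of [f] to the span of [B] differs from [f] by a vector
    orthogonal to [B], that is, by zero; so [f] is a limit of elements of the
    span, and [hproj s f] is the best approximation of [f] that uses only [s]. *)
Lemma parseval_le_approx f (e : R) : 0 < e ->
  exists s, [/\ uniq s, (forall b, b \in s -> B b) &
    sqn f <= \sum_(b <- s) abs2 (dot f b) + e].
Proof.
move=> e0; have [Bon Bmax] := Bonb.
(* The span of B: being in the double orthogonal of a finite subset of B is
   stable under linear combinations without any bookkeeping of coefficients. *)
pose M m := exists s, [/\ uniq s, (forall b, b \in s -> B b) &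
  forall h, (forall b, b \in s -> dot h b = 0) -> dot h m = 0].
have [||g [gM gorth]] := @orthogonal_projection _ _ _ H M _ _ f.
- by exists [::]; split => // h _; rewrite (hdot0r H).
- move=> a u v [s [us sB su]] [t [ut tB tv]]; exists (undup (s ++ t)); split.
  + exact: undup_uniq.
  + by move=> b; rewrite mem_undup mem_cat => /orP[/sB|/tB].
  + move=> h hst; rewrite (hdotDr H) (hdotZr H) su ?tv ?mulr0 ?addr0//.
      by move=> b bt; apply: hst; rewrite mem_undup mem_cat bt orbT.
    by move=> b bs; apply: hst; rewrite mem_undup mem_cat bs.
have fg : f = g.
  apply/eqP; rewrite -subr_eq0; apply/eqP/Bmax => b Bb; apply: gorth.
  exists [:: b]; split => //; first by move=> c; rewrite inE => /eqP ->.
  by move=> h /(_ b (mem_head _ _)).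
have [m [s [us sB sm]] mg] := gM e e0; exists s; split => //.
rewrite (@bessel_eq _ s Bon us sB f) addrC lerD2l.
apply: le_trans (ltW mg); rewrite -fg -(sqnN H (m - f)) opprB.
have orth b : b \in s -> dot (f - hproj s f) b = 0.
  by move=> bs; exact: (@dot_subproj _ _ Bon).
have -> : f - m = (f - hproj s f) + (hproj s f - m) by rewrite addrA subrK.
rewrite [leRHS]pythagoras; first by rewrite lerDl (sqn_ge0 H).
by rewrite (hdotBr H) dot_projr// sm// subr0.
Qed.

Theorem parseval f : (\esum_(e in B) (abs2 (dot f e))%:E = (sqn f)%:E)%E.
Proof.
have [Bon Bmax] := Bonb; apply/eqP; rewrite eq_le; apply/andP; split.
  apply: ge_ereal_sup => _ [X [Xfin XB] <-].
  rewrite fsbig_finite//= sumEFin lee_fin; apply: (@bessel B) => //.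
    exact: fset_uniq.
  by move=> e; rewrite in_fset_set// inE => /XB.
apply/lee_addgt0Pr => e e0.
have [s [us sB sf]] := parseval_le_approx f e0.
rewrite (@le_trans _ _ ((\sum_(b <- s) abs2 (dot f b))%:E + e%:E))%E//.
rewrite leeD2r//; apply: esum_ge; exists [set` s]; first by split; [exact: finite_seq|move=> b /sB].
by rewrite -fsbig_seq// sumEFin.
Qed.

End parseval.

End orthonormal_bases.

Arguments orthonormal_set {R V} dot B.
Arguments is_onb {R V} dot B.
Arguments hproj {R V} dot s f.

(** [csum] splits a real family into positive and negative parts; any other way
    of writing it as a difference of summable nonnegative families gives the same
    sum. *)
Lemma rsumB {R : realType} {I : choiceType} (D : set I) (b c : I -> R) :
    (forall i, 0 <= b i) -> (forall i, 0 <= c i) ->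
    (\esum_(i in D) (b i)%:E < +oo)%E -> (\esum_(i in D) (c i)%:E < +oo)%E ->
  fine (esum D ((EFin \o (fun i => (b i - c i)%R))^\+)%E) -
  fine (esum D ((EFin \o (fun i => (b i - c i)%R))^\-)%E) =
  fine (\esum_(i in D) (b i)%:E)%E - fine (\esum_(i in D) (c i)%:E)%E.
Proof.
move=> b0 c0 bfin cfin.
have fin_le (x y : I -> \bar R) : (forall i, (0 <= x i <= y i)%E) ->
    (\esum_(i in D) y i < +oo)%E -> (\esum_(i in D) x i \is a fin_num)%E.
  move=> xy yfin; rewrite ge0_fin_numE; last first.
    by apply: esum_ge0 => i _; case/andP: (xy i).
  by apply: le_lt_trans yfin; apply: le_esum => i _; case/andP: (xy i).
have bb i : (0 <= (b i)%:E <= (b i)%:E)%E by rewrite lee_fin b0 lexx.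
have cc i : (0 <= (c i)%:E <= (c i)%:E)%E by rewrite lee_fin c0 lexx.
rewrite -!fineB; [congr fine|exact: fin_le bfin|exact: fin_le cfin|..].
- rewrite -[RHS](@esumB R I D (fun i => (b i)%:E) (fun i => (c i)%:E))//.
  + rewrite /summable (eq_esum (b := fun i => (b i)%:E))// => i _.
    by rewrite gee0_abs// lee_fin.
  + rewrite /summable (eq_esum (b := fun i => (c i)%:E))// => i _.
    by rewrite gee0_abs// lee_fin.
  + by move=> i _; rewrite lee_fin.
  + by move=> i _; rewrite lee_fin.
- apply: fin_le bfin => i /=; rewrite funepos_ge0 funeposE/= ge_max !lee_fin.
  by rewrite b0 lerBlDr lerDl c0.
- apply: fin_le cfin => i /=; rewrite funeneg_ge0 funenegE/= ge_max !lee_fin.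
  by rewrite c0 opprB lerBlDr lerDl b0.
Qed.

Section csum_parseval.
Context {R : realType} {V : lmodType R[i]} {dot : V -> V -> R[i]}.
Hypothesis H : hilbert_space dot.
Variable B : set V.
Hypothesis Bonb : is_onb dot B.
Local Notation Re := (@complex.Re R).

Let rsum (a : V -> R) := fine (esum B ((EFin \o a)^\+)%E) -
  fine (esum B ((EFin \o a)^\-)%E).

Let rsum_dot f g : rsum (fun e => Re (dot f e * conjc (dot g e))) = Re (dot f g).
Proof.
pose u := (2^-1)%:C *: (f + g); pose v := (2^-1)%:C *: (f - g).
have -> : (fun e => Re (dot f e * conjc (dot g e))) =
    (fun e => abs2 (dot u e) - abs2 (dot v e)).
  apply/funext => e; rewrite !(hdotZl H) (hdotDl H) (hdotBl H).
  by case: (dot f e) (dot g e) => [a b] [c d]; rewrite /abs2; simpc => /=; field.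
rewrite /rsum rsumB; last 4 first.
- by move=> e; exact: abs2_ge0.
- by move=> e; exact: abs2_ge0.
- by rewrite (parseval H) ?ltry.
- by rewrite (parseval H) ?ltry.
rewrite !(parseval H)//= !(sqnZ H) !abs2_real (sqnD H) (sqnB H).
by field.
Qed.

(** Polarization reduces this to Parseval's identity: the real part of z w^* is
    |(z + w)/2|^2 - |(z - w)/2|^2, and the imaginary part of z w^* is the real part
    of z (i w)^*. *)
Theorem csum_parseval f g :
  csum B (fun e => dot f e * conjc (dot g e)) = dot f g.
Proof.
rewrite /csum [RHS]complex_split; congr (_ +i* _); first exact: rsum_dot.
have Imi (z w : R[i]) : complex.Im (z * conjc w) = Re (z * conjc ('i * w)).
  by case: z w => [a b] [c d]; simpc => /=; ring.
rewrite -[LHS]/(rsum (fun e => complex.Im (dot f e * conjc (dot g e)))).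
under eq_fun do rewrite Imi -(hdotZl H).
rewrite rsum_dot (hdotZr H).
by case: (dot f g) => [a b]; simpc.
Qed.

End csum_parseval.

(** * Extremal problems for quadratic forms on a Hilbert space *)
Section subsequences.
Context {R : realType}.
Implicit Types (x : nat -> R).

Definition cauchy_real x := forall e : R, 0 < e -> exists N, forall m n,
  (N <= m)%N -> (N <= n)%N -> (x m - x n) ^+ 2 < e.

(** The extraction [phi] need not be increasing: it is enough that it tends to
    infinity. *)
Lemma bolzano_weierstrass x (M : R) : (forall n, `|x n| <= M) ->
  exists2 phi : nat -> nat, (forall j, (j <= phi j)%N) & cauchy_real (x \o phi).
Proof.
move=> xM.
have xin : (x @ \oo) `[- M, M]%classic.
  by exists 0%N => // n _ /=; rewrite in_itv/= -ler_norml.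
have PF : ProperFilter (x @ \oo) by exact: fmap_proper_filter.
have [l [_ lcl]] := segment_compact PF xin.
have /choice[phi phiP] j : exists k : nat, (j <= k)%N /\ `|(l : R) - x k| < (natSinv j : R).
  have lnb : nbhs (l : R) (ball (l : R) (natSinv j)).
    by apply: nbhsx_ballx; exact: natSinv_gt0.
  have [|_ [[k jk <-] lk]] := lcl [set x k | k in [set k | (j <= k)%N]] _ _ lnb.
    by exists j => // k jk; exists k.
  by exists k.
exists phi => [j|e e0]; first by have [] := phiP j.
have e4 : 0 < Num.min 1 (e / 4) by rewrite lt_min ltr01 divr_gt0.
have [N HN] := natSinv_lt e4.
exists N => m n Nm Nn; have [[_ mP] [_ nP]] := (phiP m, phiP n).
have : `|x (phi m) - x (phi n)| < 2 * Num.min 1 (e / 4).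
  rewrite (le_lt_trans (ler_distD l _ _))// mulr_natl mulr2n ltrD//.
    by rewrite distrC (lt_trans mP)//; exact: HN.
  by rewrite (lt_trans nP)//; exact: HN.
rewrite /= -real_normK ?num_real//; move: `|_ - _| (normr_ge0 (x (phi m) - x (phi n))).
move=> y y0; set t := Num.min _ _ => yt.
have t1 : t <= 1 by rewrite ge_min lexx.
have te : t <= e / 4 by rewrite ge_min lexx orbT.
rewrite expr2; have : y * y < (2 * t) * (2 * t) by rewrite ltr_pM.
have t0 : 0 <= t by lra.
have : t * t <= t by rewrite ler_piMr.
by lra.
Qed.

Lemma diagonal_subsequence (I : eqType) (s : seq I) (x : I -> nat -> R) (M : R) :
  (forall i n, `|x i n| <= M) ->
  exists2 phi : nat -> nat, (forall j, (j <= phi j)%N) &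
    forall i, i \in s -> cauchy_real (x i \o phi).
Proof.
move=> xM; elim: s => [|i s [phi phij IH]]; first by exists id.
have [psi psij xi] := @bolzano_weierstrass (x i \o phi) M (fun n => xM i (phi n)).
exists (phi \o psi) => [j|k]; first by rewrite (leq_trans (psij j)).
rewrite inE => /orP[/eqP -> //|/IH xk e e0].
have [N HN] := xk e e0; exists N => m n Nm Nn.
by apply: HN; apply: leq_trans (psij _).
Qed.

End subsequences.

Section extremal.
Context {R : realType} {V : lmodType R[i]} {dot : V -> V -> R[i]}.
Hypothesis H : hilbert_space dot.
Local Notation C := R[i].
Local Notation Re := (@complex.Re R).
Local Notation sqn := (sqnorm dot).
Local Notation nrm := (hnorm dot).
Local Notation hlim := (hlimit dot).
Implicit Types (u v w f g : V) (a : C).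

(** [p] is the square of a bounded seminorm; [qs_add] is the consequence of the
    parallelogram law that replaces the triangle inequality. *)
Record quadratic_seminorm (p : V -> R) (K : R) : Prop := QuadraticSeminorm {
  qs_ge0 : forall f, 0 <= p f;
  qs_add : forall f g, p (f + g) <= 2 * p f + 2 * p g;
  qs_scale : forall a f, p (a *: f) = abs2 a * p f;
  qs_bound : forall f, p f <= K * sqn f }.

Lemma qsN p K : quadratic_seminorm p K -> forall f, p (- f) = p f.
Proof.
move=> pP f; rewrite -scaleN1r (qs_scale pP).
by rewrite /abs2/= oppr0 expr0n addr0 sqrrN expr1n mul1r.
Qed.

Lemma qsB p K : quadratic_seminorm p K ->
  forall f g, p (f - g) <= 2 * p f + 2 * p g.
Proof. by move=> pP f g; rewrite -(qsN pP g) (qs_add pP). Qed.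

Lemma qs0 p K : quadratic_seminorm p K -> p 0 = 0.
Proof. by move=> pP; rewrite -(scale0r 0) (qs_scale pP) abs20 mul0r. Qed.

Lemma abs2_dot_le1 f e : sqn f = 1 -> sqn e = 1 -> abs2 (dot f e) <= 1.
Proof. by move=> f1 e1; rewrite (le_trans (cauchy_schwarz H _ _))// f1 e1 mulr1. Qed.

(** The projections to a finite-dimensional subspace have bounded coordinates, so
    that Bolzano-Weierstrass applies to each real coordinate in turn. *)
Lemma proj_subsequence (s : seq V) (f : nat -> V) :
    orthonormal_set dot [set` s] -> uniq s -> (forall n, sqn (f n) = 1) ->
  exists2 phi : nat -> nat, (forall j, (j <= phi j)%N) &
    forall e : R, 0 < e -> exists N, forall m n, (N <= m)%N -> (N <= n)%N ->
      sqn (hproj dot s (f (phi m)) - hproj dot s (f (phi n))) < e.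
Proof.
move=> son us f1.
(* Sends the vectors outside s to zero, so that all coordinates are bounded. *)
pose t e : V := if e \in s then e else 0.
have dte e n : abs2 (dot (f n) (t e)) <= 1.
  rewrite /t; case: ifPn => es; last by rewrite (hdot0r H) abs20.
  by apply: abs2_dot_le1 => //; rewrite /sqnorm (son e e)// eqxx.
have Reb e n : `|Re (dot (f n) (t e))| <= 1.
  rewrite -sqrtr_sqr -[leRHS]sqrtr1 ler_sqrt// (le_trans _ (dte e n))//.
  by rewrite lerDl sqr_ge0.
have Imb e n : `|complex.Im (dot (f n) (t e))| <= 1.
  rewrite -sqrtr_sqr -[leRHS]sqrtr1 ler_sqrt// (le_trans _ (dte e n))//.
  by rewrite lerDr sqr_ge0.
have [phi phij Rephi] := diagonal_subsequence s Reb.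
have [psi psij Impsi] := @diagonal_subsequence _ _ s
  (fun e n => complex.Im (dot (f (phi n)) (t e))) 1 (fun e n => Imb e (phi n)).
exists (phi \o psi) => [j|]; first by rewrite (leq_trans (psij j)).
have projB g h : hproj dot s g - hproj dot s h =
    hproj dot s (g - h).
  rewrite /hproj -sumrB; apply: eq_bigr => e _.
  by rewrite (hdotBl H) scalerBl.
suff : forall r, {subset r <= s} -> forall e : R, 0 < e -> exists N, forall m n,
    (N <= m)%N -> (N <= n)%N -> \sum_(b <- r)
      abs2 (dot (f (phi (psi m)) - f (phi (psi n))) b) < e.
  move=> /(_ s (fun x xs => xs)) sumP e e0; have [N HN] := sumP e e0.
  exists N => m n Nm Nn; rewrite projB (@sqn_proj _ _ _ H [set` s])//.
  exact: HN.
elim=> [_ e e0|b r IH rs e e0]; first by exists 0 => m n _ _; rewrite big_nil.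
have bs : b \in s by apply: rs; rewrite mem_head.
have e3 : 0 < e / 3 by rewrite divr_gt0.
have [|N1 HN1] := IH _ (e / 3) e3.
  by move=> x xr; apply: rs; rewrite inE xr orbT.
have [N2 HN2] := Rephi b bs _ e3.
have [N3 HN3] := Impsi b bs _ e3.
exists (maxn N1 (maxn N2 N3)) => m n; rewrite !geq_max.
move=> /and3P[m1 m2 m3] /and3P[n1 n2 n3]; rewrite big_cons.
have h1 := HN1 m n m1 n1.
have h2 := HN2 (psi m) (psi n) (leq_trans m2 (psij m)) (leq_trans n2 (psij n)).
have h3 := HN3 m n m3 n3.
suff -> : abs2 (dot (f (phi (psi m)) - f (phi (psi n))) b) =
    ((Re (dot (f (phi (psi m))) (t b)) - Re (dot (f (phi (psi n))) (t b))) ^+ 2 +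
    (complex.Im (dot (f (phi (psi m))) (t b)) -
     complex.Im (dot (f (phi (psi n))) (t b))) ^+ 2).
  move: h1 h2 h3 => /=; lra.
rewrite /t bs (hdotBl H); move: (dot _ _) (dot _ _) => [? ?] [? ?].
by rewrite /abs2 /=.
Qed.

(** This replaces weak compactness of the unit ball. The bound [N] gives a maximal
    orthonormal family [s] on which [p <= e0]; by maximality [p] is at least [e0]
    times the squared norm on the orthogonal complement of [s]. Split a minimizing
    sequence of unit vectors as [f k = w k + g k] with [w k] in the span of [s].
    A subsequence of [w] converges because this span has finite dimension, and
    then [g] is Cauchy because e0 |g m - g n|^2 <= p (g m - g n), where the
    right-hand side is controlled by [p (f m)], [p (f n)] and |w m - w n|^2.
    The limit of [f] is a unit vector at which [p] vanishes. *)
Theorem minimizer_exists (p : V -> R) (K e0 : R) (N : nat) :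
    quadratic_seminorm p K -> 0 < e0 ->
    (forall e : R, 0 < e -> exists2 f, sqn f = 1 & p f < e) ->
    (forall s : seq V, uniq s -> orthonormal_set dot [set` s] ->
      (forall b, b \in s -> p b <= e0) -> (size s <= N)%N) ->
  exists2 f, f != 0 & p f = 0.
Proof.
move=> pP e0p pinf pN.
pose good (n : nat) := `[< exists s : seq V, [/\ size s = n, uniq s,
  orthonormal_set dot [set` s] & forall b, b \in s -> p b <= e0] >].
have good0 : exists n, good n by exists 0%N; apply/asboolP; exists [::].
have goodN n : good n -> (n <= N)%N by move=> /asboolP[s [<- ? ? ?]]; exact: pN.
case: (ex_maxnP good0 goodN) => d /asboolP[s [sn us son sp]] nmax.
have perp u : (forall b, b \in s -> dot u b = 0) -> e0 * sqn u <= p u.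
  move=> us0; have [->|u0] := eqVneq u 0; first by rewrite (sqn0 H) (qs0 pP) mulr0.
  rewrite leNgt; apply/negP => pu.
  pose v := ((nrm u)^-1)%:C *: u.
  have nu := nrm_gt0 H u0.
  have vv : dot v v = 1.
    rewrite (hdotuu H) (sqnZ H) abs2_real -(sqr_nrm H) -exprMn mulVf ?gt_eqF//.
    by rewrite expr1n.
  have vs b : b \in s -> dot v b = 0 by move=> /us0 ub; rewrite (hdotZl H) ub mulr0.
  have sv : v \notin s.
    by apply/negP => /vs; rewrite vv => /eqP; rewrite oner_eq0.
  have /nmax : good (size (v :: s)).
    apply/asboolP; exists (v :: s); split => //; first by rewrite /= sv.
      move=> b c; rewrite /= !inE => /orP[/eqP ->|bs] /orP[/eqP ->|cs].
      - by rewrite vv eqxx.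
      - by rewrite vs//; case: eqP => // vc; move: sv; rewrite vc cs.
      - rewrite (hdotC H) vs// conjc0; case: eqP => // bv.
        by move: sv; rewrite -bv bs.
      - exact: son.
    move=> b; rewrite inE => /orP[/eqP ->|]; last exact: sp.
    rewrite (qs_scale pP) abs2_real exprVn (sqr_nrm H) mulrC.
    by rewrite ler_pdivrMr ?(sqn_gt0 H)// ltW.
  by rewrite /= sn ltnn.
have /choice[f0 f0P] k : exists f, sqn f = 1 /\ p f < natSinv k.
  by have [f] := pinf _ (natSinv_gt0 k); exists f.
have [phi phij wcau] := proj_subsequence son us (fun n => (f0P n).1).
pose f k := f0 (phi k).
have f1 k : sqn (f k) = 1 by have [] := f0P (phi k).
have pf k : p (f k) < natSinv k.
  have [_ pk] := f0P (phi k); apply: (lt_le_trans pk).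
  by rewrite /natSinv lef_pV2 ?posrE// ler_nat ltnS.
pose w k := hproj dot s (f k); pose g k := f k - w k.
have K0 : 0 <= K.
  have := qs_bound pP (f 0%N); rewrite f1 mulr1; exact: le_trans (qs_ge0 pP _).
have gperp m n b : b \in s -> dot (g m - g n) b = 0.
  move=> bs; rewrite (hdotBl H) !(@dot_subproj _ _ _ H [set` s])//.
  by rewrite subrr.
have gle m n : e0 * sqn (g m - g n) <=
    4 * p (f m) + 4 * p (f n) + 2 * K * sqn (w m - w n).
  apply: (le_trans (perp _ (@gperp m n))).
  have -> : g m - g n = (f m - f n) - (w m - w n).
    by rewrite /g !opprB addrACA [in RHS]addrACA; congr (_ + _); rewrite addrC.
  apply: (le_trans (qsB pP _ _)).
  have := qsB pP (f m) (f n); have := qs_bound pP (w m - w n).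
  by rewrite -mulrA; lra.
have [l fl] : exists l, hlim f l.
  apply: (hcauchy H) => e ep.
  have ep1 : 0 < e0 * e / 64 by rewrite divr_gt0// mulr_gt0.
  have [N1 HN1] := natSinv_lt ep1.
  have ep2 : 0 < Num.min (e / 4) (e0 * e / (16 * (K + 1))).
    rewrite lt_min !divr_gt0// ?mulr_gt0// ltr_wpDl//.
  have [N2 HN2] := wcau _ ep2.
  exists (maxn N1 N2) => m n; rewrite !geq_max => /andP[m1 m2] /andP[n1 n2].
  have -> : f m - f n = (g m - g n) + (w m - w n).
    by rewrite /g addrACA subrK -opprD subrK.
  apply: (le_lt_trans (sqnD_le H _ _)).
  have := HN2 m n m2 n2; rewrite lt_min -/(f m) -/(f n) -/(w m) -/(w n).
  rewrite [X in _ && X]ltr_pdivlMr; last by apply: mulr_gt0 => //; exact: ltr_wpDl.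
  move=> /andP[we wKe].
  suff : e0 * sqn (g m - g n) < e0 * (e / 4) by rewrite ltr_pM2l//; lra.
  apply: (le_lt_trans (gle m n)).
  have := pf m; have := pf n; have := HN1 m m1; have := HN1 n n1.
  have := sqn_ge0 H (w m - w n).
  have -> : e0 * (e / 4) = e0 * e / 4 by rewrite mulrA.
  move: wKe; move: (sqn (w m - w n)) (e0 * e) ep1 => x y.
  have -> : x * (16 * (K + 1)) = 16 * (K * x) + 16 * x by ring.
  rewrite -mulrA; move: (K * x) => z; lra.
have small (e : R) : 0 < e -> exists k, sqn (f k - l) < e /\ natSinv k < e.
  move=> ep; have [N1 HN1] := natSinv_lt ep.
  have [N2 HN2] := fl (Num.sqrt e) (eqbRL (sqrtr_gt0 e) ep).
  exists (maxn N1 N2); split; last exact/HN1/leq_maxl.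
  have := HN2 (maxn N1 N2) (leq_maxr _ _).
  by rewrite (nrm_lt H) ?sqrtr_ge0// sqr_sqrtr ?(ltW ep).
exists l.
  apply/eqP => l0; have [k [+ _]] := small 1 ltr01.
  by rewrite l0 subr0 f1 ltxx.
apply/eqP; rewrite eq_le (qs_ge0 pP) andbT; apply/ler_addgt0Pr => e ep.
have K1 : 0 < K + 1 by rewrite ltr_wpDl.
have ep1 : 0 < e / (4 * (K + 1)) by rewrite divr_gt0// mulr_gt0.
have [k [h1 h2]] := small _ ep1.
have -> : l = f k - (f k - l) by rewrite opprB addrC subrK.
rewrite add0r (le_trans (qsB pP _ _))//.
have := qs_bound pP (f k - l); have := pf k.
move: h1 h2; rewrite !ltr_pdivlMr ?mulr_gt0//.
have := sqn_ge0 H (f k - l); have := @natSinv_gt0 R k.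
move: (sqn _) (natSinv k) => x i i0 x0.
have -> : x * (4 * (K + 1)) = 4 * (K * x) + 4 * x by ring.
have -> : i * (4 * (K + 1)) = 4 * (K * i) + 4 * i by ring.
have : 0 <= K * i by rewrite mulr_ge0// ltW.
by move: (K * x) (K * i) => z y; lra.
Qed.

(** A nonnegative quadratic form of finite trace attains its supremum [s] on the
    unit sphere: apply [minimizer_exists] to s |f|^2 - q f. An orthonormal family on
    which this defect is at most s/2 satisfies [q >= s/2], and has at most 2B/s
    elements since the trace is at most [B]. *)
Theorem maximizer_exists (q : V -> R) (s B : R) :
    0 < s -> (forall f, 0 <= q f) ->
    (forall f g, q (f + g) + q (f - g) = 2 * q f + 2 * q g) ->
    (forall a f, q (a *: f) = abs2 a * q f) ->
    (forall f, q f <= s * sqn f) ->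
    (forall e : R, 0 < e -> exists2 f, f != 0 & (s - e) * sqn f < q f) ->
    (forall t : seq V, uniq t -> orthonormal_set dot [set` t] ->
      \sum_(u <- t) q u <= B) ->
  exists2 f, f != 0 & q f = s * sqn f.
Proof.
move=> s0 q0 qpar qZ qs qsup qB.
pose p f := s * sqn f - q f.
have p0 f : 0 <= p f by rewrite subr_ge0.
have pp : quadratic_seminorm p s.
  split=> [//|f g|a f|f].
  - have := qpar f g; have := parallelogram H f g; have := p0 (f - g); rewrite /p.
    move: (sqn _) (sqn _) (sqn _) (sqn _) (q _) (q _) (q _) (q _).
    by move=> *; nra.
  - by rewrite /p (sqnZ H) qZ; ring.
  - by rewrite /p gerBl.
suff [f f0 pf] : exists2 f, f != 0 & p f = 0.
  by exists f => //; move: pf => /eqP; rewrite subr_eq0 => /eqP ->.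
apply: (@minimizer_exists p s (s / 2) (Num.trunc (B / (s / 2)))) => //.
- by rewrite divr_gt0.
- move=> e e0; have [f f0 fe] := qsup e e0; have nf := nrm_gt0 H f0.
  exists (((nrm f)^-1)%:C *: f).
    by rewrite (sqnZ H) abs2_real -(sqr_nrm H) -exprMn mulVf ?expr1n ?gt_eqF.
  rewrite (qs_scale pp) abs2_real exprVn (sqr_nrm H) mulrC.
  rewrite ltr_pdivrMr ?(sqn_gt0 H)// /p.
  by move: fe; lra.
move=> t ut ton tp; rewrite -ltnS.
have : (size t)%:R * (s / 2) <= B.
  apply: le_trans (qB t ut ton).
  have -> : (size t)%:R * (s / 2) = \sum_(u <- t) (s / 2) :> R.
    by rewrite big_const_seq count_predT iter_addr_0 mulr_natl.
  rewrite big_seq [leRHS]big_seq; apply: ler_sum => u ut'.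
  have := tp u ut'; rewrite /p.
  have -> : sqn u = 1 by rewrite /sqnorm (ton u u)// eqxx.
  by lra.
rewrite -ler_pdivlMr ?divr_gt0// => tB'.
by rewrite -(ltr_nat R) (le_lt_trans tB')// truncnS_gt.
Qed.

(** The proof of the Banach-Steinhaus theorem by nested balls, for quadratic forms:
    if no [M] bounds all [q n], every ball contains a smaller ball on which some
    [q n] exceeds [k]; the common point of the balls obtained for k = 0, 1, 2, ...
    is the required vector. *)
Theorem uniform_boundedness (q : nat -> V -> R) (K : nat -> R) :
    (forall n, quadratic_seminorm (q n) (K n)) ->
    (forall M : R, exists f n, M * sqn f < q n f) ->
  exists f, forall M : R, exists n, M < q n f.
Proof.
move=> qP qinf.
have step k (x : V * R) : exists y : V * R, 0 < x.2 ->
    [/\ 0 < y.2, y.2 <= x.2 / 2, y.2 <= natSinv k, nrm (y.1 - x.1) <= x.2 / 2 &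
      exists n, forall g, nrm (g - y.1) <= y.2 -> k%:R < q n g].
  case: x => f r /=.
  have [r0|] := ltP 0 r; last by move=> r0; exists (f, r).
  pose M := (k%:R + 1) * 8 / r ^+ 2.
  have [h0 [n Mh]] := qinf M.
  have M0 : 0 < M by rewrite divr_gt0 ?exprn_gt0// mulr_gt0// ltr_wpDl.
  have h00 : h0 != 0.
    by apply: contraTneq Mh => ->; rewrite (qs0 (qP n)) (sqn0 H) mulr0 ltxx.
  have nh0 := nrm_gt0 H h00.
  pose h := (r / 2 / nrm h0)%:C *: h0.
  have sh : sqn h = (r / 2) ^+ 2.
    by rewrite (sqnZ H) abs2_real -(sqr_nrm H) -exprMn divfK// gt_eqF.
  have qh : (k%:R + 1) * 2 < q n h.
    have -> : (k%:R + 1) * 2 = M * sqn h.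
      by rewrite sh /M; field; rewrite gt_eqF.
    rewrite (sqnZ H) (qs_scale (qP n)) mulrCA ltr_pM2l// abs2_real.
    by rewrite exprn_gt0// !divr_gt0.
  (* The vector h is half of the difference of f + h and f - h, so that q n is at
     least q n h at one of them. *)
  have [f' [nf' qf']] : exists f', nrm (f' - f) = r / 2 /\ (k%:R + 1) * 2 < q n f'.
    have nh : nrm h = r / 2.
      by rewrite /hnorm sh sqrtr_sqr ger0_norm// divr_ge0 ?ltW.
    have [q1|q1] := ltP ((k%:R + 1) * 2) (q n (f + h)).
      by exists (f + h); rewrite addrC addKr.
    exists (f - h); split; first by rewrite addrC addKr (nrmN H).
    have := qsB (qP n) (f + h) (f - h).
    have -> : f + h - (f - h) = (2%:R)%:C *: h.
      rewrite opprB addrCA [f + h]addrC addrK.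
      have -> : (2%:R)%:C = 1 + 1 :> C by simpc.
      by rewrite scalerDl scale1r.
    by rewrite (qs_scale (qP n)) abs2_real; lra.
  pose t := Num.min (r / 2) (Num.min (natSinv k) (Num.min 1 (2 * (`|K n| + 1))^-1)).
  have K1 : 0 < 2 * (`|K n| + 1) by rewrite mulr_gt0// ltr_wpDl.
  exists (f', t) => _ /=; split.
  - by rewrite !lt_min divr_gt0// natSinv_gt0 ltr01 invr_gt0.
  - by rewrite ge_min lexx.
  - by rewrite !ge_min lexx orbT.
  - by rewrite nf'.
  exists n => g gf.
  have t1 : t <= 1 by rewrite !ge_min lexx !orbT.
  have tK : t <= (2 * (`|K n| + 1))^-1 by rewrite !ge_min lexx !orbT.
  have t0 : 0 <= t by apply: le_trans gf; exact: sqrtr_ge0.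
  have sg : sqn (f' - g) <= t.
    rewrite -(sqr_nrm H) (nrmB H) expr2.
    apply: (@le_trans _ _ (t * t)); last by rewrite ler_piMr.
    by apply: ler_pM => //; exact: sqrtr_ge0.
  have Kg : K n * sqn (f' - g) <= 2^-1.
    rewrite (@le_trans _ _ ((`|K n| + 1) * t))//.
      rewrite (@le_trans _ _ ((`|K n| + 1) * sqn (f' - g)))//.
        rewrite ler_wpM2r ?(sqn_ge0 H)//.
        by rewrite (le_trans (ler_norm _))// lerDl.
      by rewrite ler_wpM2l// addr_ge0.
    move: tK; rewrite -[(2 * _)^-1]mul1r ler_pdivlMr//; lra.
  have := qs_add (qP n) (f' - g) g; rewrite subrK.
  have := qs_bound (qP n) (f' - g).
  lra.
have /choice[F FP] (kx : nat * (V * R)) := step kx.1 kx.2.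
pose x := fix x n := if n is m.+1 then F (m, x m) else (0 : V, 1 : R).
have x0 n : 0 < (x n).2.
  by elim: n => [|n IH] //=; have [] := FP (n, x n) IH.
have xP n := FP (n, x n) (x0 n).
have tel m n : nrm ((x (n + m)%N).1 - (x n).1) <= (x n).2 - (x (n + m)%N).2.
  elim: m => [|m IH]; first by rewrite addn0 !subrr /hnorm (sqn0 H) sqrtr0.
  rewrite addnS; have [h1 h2 h3 h4 _] := xP (n + m)%N.
  rewrite -[X in X - (x n).1](subrK (x (n + m)%N).1) -addrA.
  apply: (le_trans (nrmD H _ _)); move: IH h2 h4 => /=; lra.
have tel' m n : (n <= m)%N -> nrm ((x m).1 - (x n).1) <= (x n).2.
  move=> nm; rewrite -(subnKC nm); apply: (le_trans (tel _ _)).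
  by rewrite lerBlDr lerDl ltW.
have [l xl] : exists l, hlim (fun n => (x n).1) l.
  apply: (hcauchy H) => e e0.
  have e2 : 0 < Num.sqrt e / 2 by rewrite divr_gt0// sqrtr_gt0.
  have [N HN] := natSinv_lt e2.
  exists N.+1 => m n Nm Nn.
  rewrite -[e]sqr_sqrtr ?ltW// -(nrm_lt H) ?sqrtr_ge0//.
  rewrite -[X in X - _](subrK (x N.+1).1) -addrA.
  apply: (le_lt_trans (nrmD H _ _)).
  have h1 := tel' _ _ Nm; have := tel' _ _ Nn; rewrite (nrmB H) => h2.
  have [_ _ h3 _ _] := xP N; have h4 := HN N (leqnn _).
  by move: h1 h2 h3 h4 => /=; lra.
exists l => M.
pose k := (Num.trunc `|M|).+1.
have kM : M < k%:R.
  by rewrite (le_lt_trans (ler_norm M))// /k truncnS_gt.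
have [_ _ _ _ [n Hn]] := xP k; exists n; apply: (lt_trans kM); apply: Hn.
apply/ler_addgt0Pr => e e0.
have [N HN] := xl e e0.
rewrite -[X in X - _](subrK (x (maxn N k.+1)).1) -addrA.
apply: (le_trans (nrmD H _ _)); rewrite [leLHS]addrC lerD//.
  exact: (tel' _ k.+1 (leq_maxr _ _)).
by rewrite (nrmB H) ltW// HN// leq_maxl.
Qed.

End extremal.

Arguments quadratic_seminorm {R V} dot p K.

(** * Integrals of complex functions *)
Section complex_integral.
Context {dT} {T : measurableType dT} {R : realType}.
Variable mu : {measure set T -> \bar R}.
Local Notation Re := (@complex.Re R).
Local Notation Im := (@complex.Im R).
Implicit Types F G : T -> R[i].

Definition cmeasurable F :=
  measurable_fun setT (Re \o F) /\ measurable_fun setT (Im \o F).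

Lemma cmeasurableM F G : cmeasurable F -> cmeasurable G ->
  cmeasurable (fun t => F t * G t).
Proof.
move=> [rF iF] [rG iG]; split.
  rewrite (_ : _ \o _ = (Re \o F) \* (Re \o G) \- (Im \o F) \* (Im \o G)).
    by apply: measurable_funB; exact: measurable_funM.
  by apply/funext => t /=; case: (F t) (G t) => [a b] [c d].
rewrite (_ : _ \o _ = (Re \o F) \* (Im \o G) \+ (Im \o F) \* (Re \o G)).
  by apply: measurable_funD; exact: measurable_funM.
by apply/funext => t /=; case: (F t) (G t) => [a b] [c d].
Qed.

Lemma cmeasurableD F G : cmeasurable F -> cmeasurable G ->
  cmeasurable (fun t => F t + G t).
Proof.
move=> [rF iF] [rG iG]; split.
  rewrite (_ : _ \o _ = (Re \o F) \+ (Re \o G)); first exact: measurable_funD.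
  by apply/funext => t /=; case: (F t) (G t) => [a b] [c d].
rewrite (_ : _ \o _ = (Im \o F) \+ (Im \o G)); first exact: measurable_funD.
by apply/funext => t /=; case: (F t) (G t) => [a b] [c d].
Qed.

Lemma cmeasurable_cst (a : R[i]) : cmeasurable (fun _ => a).
Proof. by split; exact: measurable_cst. Qed.

Lemma cmeasurableB F G : cmeasurable F -> cmeasurable G ->
  cmeasurable (fun t => F t - G t).
Proof.
move=> mF mG.
rewrite (_ : (fun t => _) = fun t => F t + (-1) * G t).
  by apply: cmeasurableD => //; apply: cmeasurableM => //; exact: cmeasurable_cst.
by apply/funext => t; rewrite mulN1r.
Qed.

Lemma cmeasurableJ F : cmeasurable F -> cmeasurable (fun t => conjc (F t)).
Proof.
move=> [rF iF]; split.
  by rewrite (_ : _ \o _ = Re \o F)//; apply/funext => t /=; case: (F t).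
rewrite (_ : _ \o _ = \- (Im \o F)); first exact: measurable_funN.
by apply/funext => t /=; case: (F t).
Qed.

Lemma cmeasurable_abs2 F : cmeasurable F -> measurable_fun setT (fun t => abs2 (F t)).
Proof. by move=> [rF iF]; apply: measurable_funD; exact: measurable_funX. Qed.

Lemma cmeasurable_eabs2 F : cmeasurable F ->
  measurable_fun setT (fun t => (abs2 (F t))%:E).
Proof. by move=> mF; apply/measurable_EFinP; exact: cmeasurable_abs2. Qed.

Lemma cintegralD F G : cintegrable mu setT F -> cintegrable mu setT G ->
  cintegral mu setT (fun t => F t + G t) = cintegral mu setT F + cintegral mu setT G.
Proof.
move=> [rF iF] [rG iG]; rewrite /cintegral; simpc; congr (_ +i* _).
  by under eq_Rintegral do rewrite cReD; exact: RintegralD.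
by under eq_Rintegral do rewrite cImD; exact: RintegralD.
Qed.

Let integrableZ (a : R) (f : T -> R) : mu.-integrable setT (fun x => (f x)%:E) ->
  mu.-integrable setT (fun x => (a * f x)%:E).
Proof. by move=> fi; under eq_fun do rewrite EFinM; exact: integrableZl. Qed.

Lemma cintegrableZ (a : R[i]) F : cintegrable mu setT F ->
  cintegrable mu setT (fun t => a * F t).
Proof.
case: a => a b [rF iF]; split.
  rewrite (_ : (fun x => _) = (fun x => (a * Re (F x))%:E - (b * Im (F x))%:E)%E).
    by apply: integrableB => //; exact: integrableZ.
  by apply/funext => t; case: (F t).
rewrite (_ : (fun x => _) = (fun x => (a * Im (F x))%:E + (b * Re (F x))%:E)%E).
  by apply: integrableD => //; exact: integrableZ.
by apply/funext => t; case: (F t).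
Qed.

Lemma cintegralZ (a : R[i]) F : cintegrable mu setT F ->
  cintegral mu setT (fun t => a * F t) = a * cintegral mu setT F.
Proof.
case: a => a b [rF iF]; rewrite /cintegral; simpc; congr (_ +i* _).
  under eq_Rintegral => t _.
    rewrite (_ : Re _ = a * Re (F t) - b * Im (F t)); last by case: (F t).
    over.
  rewrite RintegralB//; [|exact: integrableZ|exact: integrableZ].
  by rewrite !RintegralZl.
under eq_Rintegral => t _.
  rewrite (_ : Im _ = a * Im (F t) + b * Re (F t)); last by case: (F t).
  over.
rewrite RintegralD//; [|exact: integrableZ|exact: integrableZ].
by rewrite !RintegralZl.
Qed.

Lemma cintegralJ F : cintegrable mu setT F ->
  cintegral mu setT (fun t => conjc (F t)) = conjc (cintegral mu setT F).
Proof.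
move=> [rF iF]; rewrite /cintegral /=; congr (_ +i* _).
  by apply: eq_Rintegral => t _; case: (F t).
under eq_Rintegral => t _.
  rewrite (_ : Im _ = (-1) * Im (F t)); last by case: (F t) => *; rewrite mulN1r.
  over.
by rewrite RintegralZl// mulN1r.
Qed.

Lemma ae_eq_cintegral F G : cmeasurable F -> cmeasurable G ->
  {ae mu, forall t, F t = G t} -> cintegral mu setT F = cintegral mu setT G.
Proof.
move=> [rF iF] [rG iG] FG; rewrite /cintegral /Rintegral; congr (fine _ +i* fine _).
  apply: ae_eq_integral => //; try exact/measurable_EFinP.
  by apply: filterS FG => t FGt _; rewrite FGt.
apply: ae_eq_integral => //; try exact/measurable_EFinP.
by apply: filterS FG => t FGt _; rewrite FGt.
Qed.

Lemma abs2_cintegrable F G : cmeasurable F -> cmeasurable G ->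
    (\int[mu]_t (abs2 (F t))%:E < +oo)%E -> (\int[mu]_t (abs2 (G t))%:E < +oo)%E ->
  cintegrable mu setT (fun t => F t * G t).
Proof.
move=> mF mG iF iG.
have mFG := cmeasurableM mF mG.
have ge0 t : 0 <= abs2 (F t) + abs2 (G t).
  exact: addr_ge0 (abs2_ge0 _) (abs2_ge0 _).
have iFG : mu.-integrable setT (fun t => (abs2 (F t) + abs2 (G t))%:E).
  apply/integrableP; split.
    apply/measurable_EFinP; apply: measurable_funD; exact: cmeasurable_abs2.
  under eq_integral => t _ do rewrite gee0_abs ?lee_fin ?ge0// EFinD.
  rewrite ge0_integralD//; [exact: lte_add_pinfty|..].
  - by move=> t _; rewrite lee_fin abs2_ge0.
  - exact: cmeasurable_eabs2.
  - by move=> t _; rewrite lee_fin abs2_ge0.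
  - exact: cmeasurable_eabs2.
have bound (z w : R[i]) : `|Re (z * w)| <= abs2 z + abs2 w /\
    `|Im (z * w)| <= abs2 z + abs2 w.
  case: z w => [a b] [c d]; rewrite /abs2 /=.
  have := (sqr_ge0 (a + c), sqr_ge0 (a - c), sqr_ge0 (b + d), sqr_ge0 (b - d)).
  have := (sqr_ge0 (a + d), sqr_ge0 (a - d), sqr_ge0 (b + c), sqr_ge0 (b - c)).
  move=> [[[h1 h2] h3] h4] [[[h5 h6] h7] h8].
  by split; rewrite ler_norml; apply/andP; split; nra.
split; apply: (le_integrable _ _ _ iFG) => //.
- by apply/measurable_EFinP; case: mFG.
- move=> t _; rewrite /= lee_fin [leRHS]ger0_norm ?ge0//.
  by case: (bound (F t) (G t)).
- by apply/measurable_EFinP; case: mFG.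
- move=> t _; rewrite /= lee_fin [leRHS]ger0_norm ?ge0//.
  by case: (bound (F t) (G t)).
Qed.

Lemma Lfun2P (f : T -> R) : f \in Lfun mu 2%:E <->
  measurable_fun setT f /\ (\int[mu]_t (f t ^+ 2)%:E < +oo)%E.
Proof.
split=> [f2|[mf f2]].
  have := f2; rewrite inE => /andP[/[!inE]/= mf _]; split => //.
  have /integrableP[_] := Lfun2_integrable_sqr f2.
  by under eq_integral do rewrite gee0_abs ?lee_fin ?sqr_ge0//.
rewrite inE; apply/andP; split; rewrite inE//= /finite_norm unlock.
apply: poweR_lty; apply: le_lt_trans f2.
by under eq_integral => t _ do rewrite /= powR_mulrn// real_normK ?num_real//.
Qed.

End complex_integral.

(** * The scalar product of square-integrable functions *)
Section L2_scalar_product.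
Context {R : realType} {d : nat}.
Local Notation C := R[i].
Local Notation L2 := (L2 R d).
Local Notation mu := (lebesgue_tuple R d).
Local Notation T := (Euclid R d).
Local Notation Re := (@complex.Re R).
Local Notation Im := (@complex.Im R).
Implicit Types (f g : L2) (F G : T -> C).

Lemma square_integrableP F : F \in @square_integrable R d <->
  cmeasurable F /\ (\int[mu]_t (abs2 (F t))%:E < +oo)%E.
Proof.
split=> [/andP[/Lfun2P[mr ir] /Lfun2P[mi ii]]|[[mr mi] iF]].
  split; first by split.
  under eq_integral do rewrite EFinD.
  rewrite ge0_integralD//; [exact: lte_add_pinfty|..].
  - by move=> t _; rewrite lee_fin sqr_ge0.
  - by apply/measurable_EFinP; exact: measurable_funX.
  - by move=> t _; rewrite lee_fin sqr_ge0.
  - by apply/measurable_EFinP; exact: measurable_funX.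
have mabs : measurable_fun setT (fun t => (abs2 (F t))%:E).
  exact: cmeasurable_eabs2.
apply/andP; split; apply/Lfun2P; split => //; apply: le_lt_trans iF.
  apply: ge0_le_integral => //.
  - by move=> t _; rewrite lee_fin sqr_ge0.
  - by apply/measurable_EFinP; exact: measurable_funX.
  - by move=> t _; rewrite lee_fin lerDl sqr_ge0.
apply: ge0_le_integral => //.
- by move=> t _; rewrite lee_fin sqr_ge0.
- by apply/measurable_EFinP; exact: measurable_funX.
- by move=> t _; rewrite lee_fin lerDr sqr_ge0.
Qed.

Lemma L2_sqint f : (f : T -> C) \in @square_integrable R d.
Proof. exact: (valP (repr f)). Qed.

Lemma L2_cmeas f : cmeasurable f.
Proof. by have /square_integrableP[] := L2_sqint f. Qed.

Lemma L2_int f : (\int[mu]_t (abs2 (f t))%:E < +oo)%E.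
Proof. by have /square_integrableP[] := L2_sqint f. Qed.

Lemma pi_eqP (f g : @sqfun R d) :
  \pi_L2 f = \pi_L2 g <-> {ae mu, forall t, f t = g t}.
Proof.
split=> [/eqP|fg].
  rewrite -Quotient.idealrBE => /asboolP; apply: filterS => t.
  by rewrite -[LHS]/(f t - g t) => /eqP; rewrite subr_eq0 => /eqP.
apply/eqP; rewrite -Quotient.idealrBE; apply/asboolP; apply: filterS fg => t fgt.
by rewrite -[LHS]/(f t - g t) fgt subrr.
Qed.

Lemma L2_pi (f : @sqfun R d) : {ae mu, forall t, (\pi_L2 f : L2) t = f t}.
Proof. by apply/pi_eqP; rewrite reprK. Qed.

Lemma L2_eqP f g : f = g <-> {ae mu, forall t, f t = g t}.
Proof. by rewrite -[f in f = _]reprK -[g in _ = g]reprK; exact: pi_eqP. Qed.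

Lemma L2_linear (a : C) f g : {ae mu, forall t, (a *: f + g : L2) t = a * f t + g t}.
Proof.
have -> : a *: f + g = \pi_L2 (a *: repr f + repr g).
  rewrite -[f in LHS]reprK -[g in LHS]reprK.
  by rewrite !piE.
exact: L2_pi.
Qed.

Lemma L2_zero : {ae mu, forall t, (0 : L2) t = 0}.
Proof.
have -> : 0 = \pi_L2 0 :> L2 by rewrite piE.
by apply: filterS (L2_pi 0) => t ->.
Qed.

Lemma L2_sub f g : {ae mu, forall t, (f - g : L2) t = f t - g t}.
Proof.
have := L2_linear (-1) g f; rewrite scaleN1r addrC.
by apply: filterS => t ->; rewrite mulN1r addrC.
Qed.

Definition mkL2 F (hF : F \in @square_integrable R d) : L2 := \pi_L2 (SqFun hF).

Lemma mkL2E F (hF : F \in @square_integrable R d) :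
  {ae mu, forall t, mkL2 hF t = F t}.
Proof. exact: L2_pi. Qed.

Lemma cmeas_dot f g : cmeasurable (fun t => f t * conjc (g t)).
Proof.
by apply: cmeasurableM; [exact: L2_cmeas|apply: cmeasurableJ; exact: L2_cmeas].
Qed.

Lemma cint_dot f g : cintegrable mu setT (fun t => f t * conjc (g t)).
Proof.
apply: abs2_cintegrable; [exact: L2_cmeas| |exact: L2_int|].
  by apply: cmeasurableJ; exact: L2_cmeas.
by under eq_integral do rewrite abs2J; exact: L2_int.
Qed.

Lemma dotL2E f g : dotL2 f g = cintegral mu setT (fun t => f t * conjc (g t)).
Proof. by []. Qed.

Lemma dotL2_ae f g F G : cmeasurable F -> cmeasurable G ->
  {ae mu, forall t, f t = F t} -> {ae mu, forall t, g t = G t} ->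
  dotL2 f g = cintegral mu setT (fun t => F t * conjc (G t)).
Proof.
move=> mF mG fF gG; rewrite dotL2E; apply: ae_eq_cintegral.
- exact: cmeas_dot.
- by apply: cmeasurableM => //; exact: cmeasurableJ.
- by apply: filterS2 fF gG => t -> ->.
Qed.

Lemma EFin_dotL2 f : (Re (dotL2 f f))%:E = (\int[mu]_t (abs2 (f t))%:E)%E.
Proof.
rewrite dotL2E /cintegral /= /Rintegral.
under eq_integral do rewrite mulcJ /=.
by rewrite fineK// ge0_fin_numE ?L2_int// integral_ge0// => t _; rewrite lee_fin abs2_ge0.
Qed.

Lemma EFin_dotL2_ae f F : cmeasurable F -> {ae mu, forall t, f t = F t} ->
  (Re (dotL2 f f))%:E = (\int[mu]_t (abs2 (F t))%:E)%E.
Proof.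
move=> mF fF; rewrite EFin_dotL2; apply: ge0_ae_eq_integral => //.
- exact/cmeasurable_eabs2/L2_cmeas.
- exact/cmeasurable_eabs2.
- by move=> t _; rewrite lee_fin abs2_ge0.
- by move=> t _; rewrite lee_fin abs2_ge0.
- by apply: filterS fF => t -> .
Qed.

End L2_scalar_product.

(** * Completeness of the space of square-integrable functions *)
Section real_sequences.
Context {R : realType}.

Lemma cvg_geometric_increments (x : nat -> R) (M : R) :
  (forall n, `|x n.+1 - x n| <= M * (2^-1) ^+ n) -> cvgn x.
Proof.
move=> xM.
have M0 : 0 <= M by have := le_trans (normr_ge0 _) (xM 0%N); rewrite expr0 mulr1.
suff : cvgn (series (telescope x)).
  move=> h; rewrite [x](_ : _ = fun n => x 0%N + series (telescope x) n); last first.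
    by apply/funext => n; exact: eq_sum_telescope.
  by apply: is_cvgD => //; exact: is_cvg_cst.
apply: normed_cvg => /=.
apply: (@series_le_cvg _ _ (geometric M 2^-1)).
- by move=> n; exact: normr_ge0.
- by move=> n; rewrite /geometric /= mulr_ge0// exprn_ge0// invr_ge0.
- by move=> n; exact: xM.
- by apply: is_cvg_geometric_series; rewrite ger0_norm ?invr_ge0// invf_lt1// ltr1n.
Qed.

Lemma limn_einf_le (u : nat -> \bar R) (e : \bar R) N :
  (forall n, (N <= n)%N -> (u n <= e)%E) -> (limn_einf u <= e)%E.
Proof.
move=> ue; rewrite limn_einf_lim; apply: lime_le; first exact: is_cvg_einfs.
exists N => // n /= Nn; apply: (@le_trans _ _ (u n)); last exact: ue.
by apply: ereal_inf_lbound; exists n => /=.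
Qed.

End real_sequences.

Lemma measurable_oppe {dT} {T : measurableType dT} {R : realType} (h : T -> \bar R) :
  measurable_fun setT h -> measurable_fun setT (fun t => - h t)%E.
Proof. by move=> mh; apply: (measurableT_comp (@oppe_measurable R setT)). Qed.

Section L2_complete.
Context {R : realType} {d : nat}.
Local Notation C := R[i].
Local Notation L2 := (L2 R d).
Local Notation mu := (lebesgue_tuple R d).
Local Notation T := (Euclid R d).
Local Notation Re := (@complex.Re R).
Local Notation Im := (@complex.Im R).
Local Notation sq f := (Re (dotL2 f f)).
Implicit Types (f g : L2).

Lemma dist_dotL2 f g :
  (sq (f - g))%:E = (\int[mu]_t (abs2 (f t - g t))%:E)%E.
Proof.
apply: EFin_dotL2_ae; last exact: L2_sub.
by apply: cmeasurableB; exact: L2_cmeas.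
Qed.

(** The series of the functions 4^j |v_{j+1} - v_j|^2 has an integral of at most
    the sum of the 2^-(j+1), hence is finite almost everywhere, and each of its
    terms is bounded by its sum. *)
Lemma fast_cauchy_ae (v : nat -> L2) :
    (forall j, sq (v j.+1 - v j) <= (2 * 8 ^+ j)^-1) ->
  {ae mu, forall t, exists M, forall j,
    abs2 (v j.+1 t - v j t) <= M * (4^-1) ^+ j}.
Proof.
move=> vj.
pose G j t : R := 4 ^+ j * abs2 (v j.+1 t - v j t).
have G0 j t : 0 <= G j t by rewrite mulr_ge0 ?exprn_ge0 ?abs2_ge0.
have mabs j : measurable_fun setT (fun t => abs2 (v j.+1 t - v j t)).
  by apply: cmeasurable_abs2; apply: cmeasurableB; exact: L2_cmeas.
have mG j : measurable_fun setT (fun t => (G j t)%:E).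
  by apply/measurable_EFinP; apply: measurable_funM.
have iG : mu.-integrable setT (fun t => \sum_(0 <= j <oo) (G j t)%:E)%E.
  apply/integrableP; split.
    by apply: ge0_emeasurable_sum => //= j t _; rewrite lee_fin.
  under eq_integral => t _.
    rewrite gee0_abs; last by apply: nneseries_ge0 => j _ _; rewrite lee_fin.
    over.
  rewrite integral_nneseries//; last by move=> j t _; rewrite lee_fin.
  apply: le_lt_trans (ltry 1).
  apply: le_trans (@epsilon_trick0 R 1 predT ler01).
  apply: lee_nneseries => [j _ _|j _].
    by apply: integral_ge0 => t _; rewrite lee_fin.
  under eq_integral do rewrite EFinM.
  rewrite ge0_integralZl//; last 2 first.
  - exact/measurable_EFinP.
  - by move=> t _; rewrite lee_fin abs2_ge0.
  rewrite -dist_dotL2 -EFinM lee_fin.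
  apply: (@le_trans _ _ (4 ^+ j * (2 * 8 ^+ j)^-1)).
    by rewrite ler_wpM2l ?exprn_ge0.
  rewrite invfM div1r natrX exprS invfM mulrCA ler_wpM2l ?invr_ge0//.
  have -> : 8 = 4 * 2 :> R by ring.
  by rewrite exprMn invfM mulrA divff ?mul1r// expf_neq0.
have := integrable_ae measurableT iG.
apply: filterS => t /(_ I) Gfin.
exists (fine (\sum_(0 <= j <oo) (G j t)%:E)%E) => j.
have Gle : ((G j t)%:E <= \sum_(0 <= j <oo) (G j t)%:E)%E.
  rewrite (@nneseriesD1 _ _ j)//; last by move=> *; rewrite lee_fin.
  by rewrite leeDl// nneseries_ge0// => *; rewrite lee_fin.
have : G j t <= fine (\sum_(0 <= j <oo) (G j t)%:E)%E.
  by rewrite -lee_fin fineK.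
by rewrite exprVn ler_pdivlMr ?exprn_gt0// mulrC.
Qed.

Lemma fast_cauchy_limit (v : nat -> L2) :
    (forall j, sq (v j.+1 - v j) <= (2 * 8 ^+ j)^-1) ->
  exists2 F : T -> C, cmeasurable F & {ae mu, forall t,
    (fun j => Re (v j t)) @ \oo --> Re (F t) /\
    (fun j => Im (v j t)) @ \oo --> Im (F t)}.
Proof.
move=> vj.
(* The upper limit is measurable also where the sequence does not converge. *)
pose lsup (a : C -> R) t := fine (limn_esup (fun j => (a (v j t))%:E)).
have mlsup (a : C -> R) : (forall j, measurable_fun setT (a \o v j)) ->
    measurable_fun setT (lsup a).
  move=> ma; apply: (@measurableT_comp _ _ _ _ _ _ fine).
    exact: fine_measurable.
  by apply: measurable_fun_limn_esup => j; apply/measurable_EFinP; exact: ma.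
have lsupE (a : C -> R) t : cvgn (fun j => a (v j t)) ->
    (fun j => a (v j t)) @ \oo --> lsup a t.
  move=> cva; rewrite /lsup.
  have : (fun j => (a (v j t))%:E) @ \oo --> (limn (fun j => a (v j t)))%:E.
    by apply: cvg_EFin => //; exact: nearW.
  by move=> /cvg_limn_einf_sup[_ ->].
exists (fun t => lsup Re t +i* lsup Im t).
  by split; apply: mlsup => j; have [] := L2_cmeas (v j).
apply: filterS (fast_cauchy_ae vj) => t [M vM].
have incr (a : C -> R) : (forall z w, a (z - w) = a z - a w) ->
    (forall z, a z ^+ 2 <= abs2 z) -> cvgn (fun j => a (v j t)).
  move=> aB a2; apply: (@cvg_geometric_increments _ _ (Num.sqrt `|M|)) => j.
  rewrite -aB -sqrtr_sqr.
  have -> : (2^-1) ^+ j = Num.sqrt ((4^-1) ^+ j) :> R.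
    have -> : (4^-1) ^+ j = ((2^-1) ^+ j) ^+ 2 :> R.
      by rewrite -exprM mulnC exprM; congr (_ ^+ j); field.
    by rewrite sqrtr_sqr ger0_norm// exprn_ge0// invr_ge0.
  rewrite -sqrtrM// ler_wsqrtr// (le_trans (a2 _))// (le_trans (vM j))//.
  by rewrite ler_wpM2r ?ler_norm// exprn_ge0// invr_ge0.
split; apply: lsupE; apply: incr.
- by move=> [? ?] [? ?].
- by move=> z; rewrite /abs2 lerDl sqr_ge0.
- by move=> [? ?] [? ?].
- by move=> z; rewrite /abs2 lerDr sqr_ge0.
Qed.

(** Riesz-Fischer: a fast Cauchy subsequence [v] converges almost everywhere to a
    function [F], and Fatou's lemma bounds the distance from [u n] to [F] by the
    lower limit of its distances to the terms of [v]. *)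
Lemma L2_complete (u : nat -> L2) :
    (forall e : R, 0 < e -> exists N, forall m n, (N <= m)%N -> (N <= n)%N ->
      sq (u m - u n) < e) ->
  exists l, forall e : R, 0 < e -> exists N, forall n, (N <= n)%N ->
    sq (u n - l) < e.
Proof.
move=> ucau.
have /choice[N_ N_P] j : exists N, forall m n, (N <= m)%N -> (N <= n)%N ->
    sq (u m - u n) < (2 * 8 ^+ j)^-1.
  by apply: ucau; rewrite invr_gt0 mulr_gt0// exprn_gt0.
pose k j := (j + \sum_(i < j.+1) N_ i)%N.
have kN j i : (i <= j)%N -> (N_ i <= k j)%N.
  move=> ij; rewrite /k (bigD1 (Ordinal (ij : (i < j.+1)%N)))//=.
  by rewrite addnCA leq_addr.
pose v j := u (k j).
have vj j : sq (v j.+1 - v j) <= (2 * 8 ^+ j)^-1.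
  by apply/ltW/N_P; apply: kN.
have [F mF vF] := fast_cauchy_limit vj.
have dist e N : (forall m n, (N <= m)%N -> (N <= n)%N -> sq (u m - u n) < e) ->
    forall n, (N <= n)%N -> (\int[mu]_t (abs2 (u n t - F t))%:E <= e%:E)%E.
  move=> uN n Nn.
  have mB G : cmeasurable G -> measurable_fun setT (fun t => (abs2 (u n t - G t))%:E).
    move=> mG; apply: cmeasurable_eabs2; apply: cmeasurableB => //.
    exact: L2_cmeas.
  rewrite (@ae_eq_integral _ _ _ _ _
    (fun t => limn_einf (fun j => (abs2 (u n t - v j t))%:E)))//; last 3 first.
  - exact: mB.
  - rewrite [X in measurable_fun _ X](_ : _ = (fun t =>
      - limn_esup (fun j => - (abs2 (u n t - v j t))%:E))%E)//.
    apply: measurable_oppe; apply: (@measurable_fun_limn_esup _ _ _ _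
      (fun j t => - (abs2 (u n t - v j t))%:E)%E) => j.
    by apply: measurable_oppe; apply: mB; exact: L2_cmeas.
  - apply: filterS vF => t [Ret Imt] _; apply/esym.
    have : (fun j => (abs2 (u n t - v j t))%:E) @ \oo --> (abs2 (u n t - F t))%:E.
      apply: cvg_EFin; first exact: nearW.
      rewrite (_ : fine \o _ = fun j =>
        (Re (u n t) - Re (v j t)) * (Re (u n t) - Re (v j t)) +
        (Im (u n t) - Im (v j t)) * (Im (u n t) - Im (v j t))); last first.
        apply/funext => j /=; rewrite /abs2 !expr2.
        by case: (u n t) (v j t) => [? ?] [? ?].
      rewrite (_ : abs2 _ =
        (Re (u n t) - Re (F t)) * (Re (u n t) - Re (F t)) +
        (Im (u n t) - Im (F t)) * (Im (u n t) - Im (F t))); last first.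
        by rewrite /abs2 !expr2; case: (u n t) (F t) => [? ?] [? ?].
      have cvr : (fun j => Re (u n t) - Re (v j t)) @ \oo --> Re (u n t) - Re (F t).
        by apply: cvgB; [exact: cvg_cst|exact: Ret].
      have cvi : (fun j => Im (u n t) - Im (v j t)) @ \oo --> Im (u n t) - Im (F t).
        by apply: cvgB; [exact: cvg_cst|exact: Imt].
      exact: cvgD (cvgM cvr cvr) (cvgM cvi cvi).
    by move=> /cvg_limn_einf_sup[->].
  apply: le_trans (fatou _ _ _ _) _ => //.
  - by move=> j; apply: mB; exact: L2_cmeas.
  - by move=> j t _; rewrite lee_fin abs2_ge0.
  apply: (@limn_einf_le _ _ _ N) => j Nj; rewrite -dist_dotL2 lee_fin ltW// uN//.
  by rewrite (leq_trans Nj)// leq_addr.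
have Fsq : F \in @square_integrable R d.
  have [N uN] := ucau 1 ltr01.
  have -> : F = (u N : T -> C) - (fun t => u N t - F t).
    by apply/funext => t; rewrite !fctE subKr.
  apply: rpredB; first exact: L2_sqint.
  apply/square_integrableP; split.
    by apply: cmeasurableB => //; exact: L2_cmeas.
  by rewrite (le_lt_trans (dist _ _ uN N _))// ltry.
exists (mkL2 Fsq) => e e0.
have [N uN] := ucau (e / 2) (divr_gt0 e0 (ltr0n _ 2)).
exists N => n Nn.
apply: (@le_lt_trans _ _ (e / 2)); last by rewrite ltr_pdivrMr// ltr_pMr// ltr1n.
rewrite -lee_fin (@EFin_dotL2_ae _ _ _ (fun t => u n t - F t)).
- exact: dist uN n Nn.
- by apply: cmeasurableB => //; exact: L2_cmeas.
- by apply: filterS2 (L2_sub (u n) (mkL2 Fsq)) (mkL2E Fsq) => t -> ->.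
Qed.

Theorem L2_hilbert : hilbert_space (@dotL2 R d).
Proof.
split.
- move=> a u v w.
  rewrite (@dotL2_ae _ _ _ _ (fun t => a * fun_of_L2 u t + fun_of_L2 v t)
    (fun_of_L2 w))//; last 4 first.
  + apply: cmeasurableD; last exact: L2_cmeas.
    by apply: cmeasurableM; [exact: cmeasurable_cst|exact: L2_cmeas].
  + exact: L2_cmeas.
  + exact: L2_linear.
  + exact: aeW.
  rewrite (_ : (fun t => _) = fun t => a * (fun_of_L2 u t * conjc (fun_of_L2 w t)) +
    fun_of_L2 v t * conjc (fun_of_L2 w t)).
    rewrite cintegralD; [|apply: cintegrableZ|]; try exact: cint_dot.
    by rewrite cintegralZ//; exact: cint_dot.
  by apply/funext => t; rewrite mulrDl mulrA.
- move=> u v; rewrite !dotL2E -cintegralJ; last exact: cint_dot.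
  congr cintegral; apply/funext => t.
  by rewrite conjc_mul conjcK mulrC.
- move=> u; rewrite -lee_fin EFin_dotL2 integral_ge0// => t _.
  by rewrite lee_fin abs2_ge0.
- move=> u u0; apply/L2_eqP.
  have : (\int[mu]_t `|(abs2 (fun_of_L2 u t))%:E| = 0)%E.
    under eq_integral do rewrite gee0_abs ?lee_fin ?abs2_ge0//.
    by rewrite -EFin_dotL2 u0.
  move/ae_eq_integral_abs => /(_ measurableT (cmeasurable_eabs2 (L2_cmeas u))).
  move=> u0ae; apply: filterS2 u0ae L2_zero => t /(_ I)[ut0] ->.
  exact: abs2_eq0.
- exact: L2_complete.
Qed.

End L2_complete.

(** * Translation invariance of Lebesgue measure *)
Section translation.
Context {R : realType}.

Lemma measurable_subr (a : R) :
  measurable_fun setT (fun x : measurableTypeR R => x - a : measurableTypeR R).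
Proof. by apply: measurable_funB. Qed.

Lemma lebesgue_measure_translate (a : R) (A : set (measurableTypeR R)) :
  measurable A -> lebesgue_measure ((fun x : measurableTypeR R => x - a) @^-1` A) =
    lebesgue_measure A.
Proof.
move=> mA; apply/esym.
pose m := measure_function_pushforward__canonical__measure_function_Measure
  (lebesgue_measure : {measure set (measurableTypeR R) -> \bar R})
  (measurable_subr a).
apply: (@lebesgue_measure_unique R m) => // _ [[b c] _ <-] /=.
rewrite /m /= /pushforward.
rewrite [X in _ = lebesgue_measure X](_ : _ = `]b + a, c + a]%classic).
  rewrite !lebesgue_measure_itv/= !lte_fin ltrD2r; case: ifP => // _.
  by rewrite -!EFinB; congr EFin; ring.
by apply/seteqP; split => x /=; rewrite !in_itv/= ltrBrDr lerBlDr.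
Qed.

Definition translate d (y t : Euclid R d) : Euclid R d :=
  [tuple tnth t i - tnth y i | i < d].

Lemma measurable_translate d :
  measurable_fun setT (fun p : Euclid R d * Euclid R d => translate p.1 p.2).
Proof.
apply/measurable_fun_tnthP => i.
rewrite (_ : _ \o _ = (fun p : Euclid R d * Euclid R d => tnth p.2 i - tnth p.1 i)).
  apply: measurable_funB.
    exact: measurableT_comp (measurable_tnth i) measurable_snd.
  exact: measurableT_comp (measurable_tnth i) measurable_fst.
by apply/funext => p /=; rewrite tnth_mktuple.
Qed.

Lemma measurable_translatel d (y : Euclid R d) : measurable_fun setT (translate y).
Proof.
exact: (measurableT_comp (@measurable_translate d) (measurable_pair1 y)).
Qed.

(** By induction on the dimension: the image of the product measure under a
    translation agrees with the product measure on rectangles, hence everywhere. *)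
Lemma lebesgue_tuple_translate d (y : Euclid R d) (A : set (Euclid R d)) :
  measurable A -> lebesgue_tuple R d (translate y @^-1` A) = lebesgue_tuple R d A.
Proof.
elim: d y A => [|d IH] y A mA.
  congr (lebesgue_tuple R 0 _); apply/funext => t; congr (A _).
  by rewrite [LHS]tuple0 [RHS]tuple0.
rewrite /= /lebesgue_cons /pushforward.
pose y' : Euclid R d := [tuple of behead y].
pose sigma (p : measurableTypeR R * Euclid R d) :
  measurableTypeR R * Euclid R d := (p.1 - thead y, translate y' p.2).
have msigma : measurable_fun setT sigma.
  apply: measurable_fun_pair.
    exact: measurableT_comp (measurable_subr (thead y)) measurable_fst.
  exact: measurableT_comp (measurable_translatel y') measurable_snd.
rewrite [X in product_measure1 _ _ X](_ : _ = sigma @^-1` (tcons @^-1` A)); last first.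
  apply/funext => -[x t] /=; congr (A _); apply: eq_from_tnth => i.
  rewrite tnth_mktuple.
  case: (unliftP ord0 i) => [j ->|->].
    by rewrite !tnthS tnth_mktuple (tnth_nth 0 y) (tnth_nth 0 y') nth_behead.
  by rewrite !tnth0.
pose m := measure_function_pushforward__canonical__measure_function_Measure
  (lebesgue_measure \x lebesgue_tuple R d)%E msigma.
apply/esym; apply: (@product_measure_unique _ _ _ _ _
  (lebesgue_measure : {sigma_finite_measure set (measurableTypeR R) -> \bar R})
  (lebesgue_tuple R d) m); last first.
  by rewrite -[X in measurable X]setTI; exact: measurable_tcons.
move=> B D mB mD; rewrite /m /= /pushforward.
rewrite [X in product_measure1 _ _ X](_ : _ =
  ((fun x => x - thead y) @^-1` B) `*` (translate y' @^-1` D))//.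
rewrite product_measure1E ?IH//.
- by congr (_ * _)%E; exact: lebesgue_measure_translate.
- by rewrite -[X in measurable X]setTI; exact: measurable_subr.
- by rewrite -[X in measurable X]setTI; exact: measurable_translatel.
Qed.

Lemma integral_translate d (y : Euclid R d) (F : Euclid R d -> \bar R) :
    measurable_fun setT F -> (forall t, 0 <= F t)%E ->
  (\int[lebesgue_tuple R d]_t F (translate y t) = \int[lebesgue_tuple R d]_t F t)%E.
Proof.
move=> mF F0.
have := @ge0_integral_pushforward _ _ _ _ _ _ (measurable_translatel y)
  (lebesgue_tuple R d) setT F measurableT mF (fun t _ => F0 t).
rewrite preimage_setT => <-.
apply: eq_measure_integral => [|mf A mA _]; first exact: measurable_translatel.
exact: lebesgue_tuple_translate.
Qed.

Lemma ae_translate d (y : Euclid R d) (P : set (Euclid R d)) :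
  {ae lebesgue_tuple R d, forall t, P t} ->
  {ae lebesgue_tuple R d, forall t, P (translate y t)}.
Proof.
move=> [A [mA A0 PA]]; exists (translate y @^-1` A); split.
- by rewrite -[X in measurable X]setTI; exact: measurable_translatel.
- by rewrite lebesgue_tuple_translate.
- by move=> t; exact: PA.
Qed.

End translation.

(** * Time-frequency shifts *)
Section tfshift.
Context {R : realType} {d : nat}.
Local Notation C := R[i].
Local Notation L2 := (L2 R d).
Local Notation mu := (lebesgue_tuple R d).
Local Notation T := (Euclid R d).
Local Notation Z := (T * T)%type.
Local Notation Re := (@complex.Re R).
Local Notation Im := (@complex.Im R).
Local Notation sq f := (Re (dotL2 f f)).
Implicit Types (f g : L2) (z : Z).

Lemma cmeasurable_comp {d1 d2} {T1 : measurableType d1} {T2 : measurableType d2}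
    (F : T2 -> C) (h : T1 -> T2) :
  cmeasurable F -> measurable_fun setT h -> cmeasurable (fun x => F (h x)).
Proof.
by move=> [rF iF] mh; split; [exact: measurableT_comp rF mh|exact: measurableT_comp iF mh].
Qed.

Lemma abs2_expi (x : R) : abs2 (expi x) = 1.
Proof. by rewrite /abs2 /= cos2Dsin2. Qed.

Definition phase (z : Z) (t : T) : R := 2 * pi * \sum_(i < d) tnth z.2 i * tnth t i.

Lemma tfshift_funE z (F : T -> C) t :
  tfshift_fun z F t = F (translate z.1 t) * expi (phase z t).
Proof. by []. Qed.

Lemma measurable_phase : measurable_fun setT (fun p : Z * T => phase p.1 p.2).
Proof.
apply: measurable_funM; first exact: measurable_cst.
apply: measurable_sum => i; apply: measurable_funM.
  apply: (measurableT_comp (measurable_tnth i)).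
  exact: measurableT_comp measurable_snd measurable_fst.
exact: measurableT_comp (measurable_tnth i) measurable_snd.
Qed.

Lemma cmeasurable_tfshift_pair (F : T -> C) : cmeasurable F ->
  cmeasurable (fun p : Z * T => tfshift_fun p.1 F p.2).
Proof.
move=> mF; apply: cmeasurableM.
  apply: (cmeasurable_comp (h := fun p : Z * T => translate p.1.1 p.2)) => //.
  have mp : measurable_fun setT (fun p : Z * T => (p.1.1, p.2)).
    apply: measurable_fun_pair; last exact: measurable_snd.
    exact: measurableT_comp measurable_fst measurable_fst.
  exact: (measurableT_comp (@measurable_translate R d) mp).
split.
  apply: (@measurableT_comp _ _ _ _ _ _ (@cos R)); last exact: measurable_phase.
  by apply: continuous_measurable_fun; exact: continuous_cos.
apply: (@measurableT_comp _ _ _ _ _ _ (@sin R)); last exact: measurable_phase.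
by apply: continuous_measurable_fun; exact: continuous_sin.
Qed.

Lemma cmeasurable_tfshift z (F : T -> C) : cmeasurable F ->
  cmeasurable (tfshift_fun z F).
Proof.
move=> mF.
exact: (cmeasurable_comp (cmeasurable_tfshift_pair mF) (measurable_pair1 z)).
Qed.

Lemma integral_tfshift z (F : T -> C) : cmeasurable F ->
  (\int[mu]_t (abs2 (tfshift_fun z F t))%:E = \int[mu]_t (abs2 (F t))%:E)%E.
Proof.
move=> mF; rewrite -[RHS](integral_translate z.1).
- by apply: eq_integral => t _; rewrite tfshift_funE abs2M abs2_expi mulr1.
- exact: cmeasurable_eabs2.
- by move=> t; rewrite lee_fin abs2_ge0.
Qed.

Lemma tfshift_sqint z f : tfshift_fun z f \in @square_integrable R d.
Proof.
apply/square_integrableP; split.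
  exact/cmeasurable_tfshift/L2_cmeas.
by rewrite integral_tfshift ?L2_int//; exact: L2_cmeas.
Qed.

Lemma tfshift_ae z f : {ae mu, forall t, (tfshift z f : L2) t = tfshift_fun z f t}.
Proof.
rewrite /tfshift; apply: filterS (L2_pi (insubd 0 (tfshift_fun z f))) => t ->.
by rewrite -[sqfun_val _]/(val _) insubdK//; exact: tfshift_sqint.
Qed.

Lemma tfshift_linear z (a : C) f g :
  tfshift z (a *: f + g) = a *: tfshift z f + tfshift z g.
Proof.
apply/L2_eqP.
have h1 := ae_translate z.1 (L2_linear a f g).
have h2 := L2_linear a (tfshift z f) (tfshift z g).
have h3 := tfshift_ae z (a *: f + g).
have h4 := tfshift_ae z f.
have h5 := tfshift_ae z g.
apply: filterS2 (filterI h1 h2) (filterI h3 (filterI h4 h5)) => t.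
move=> [/= e1 ->] [/= -> [/= -> ->]].
by rewrite !tfshift_funE e1 mulrDl mulrA.
Qed.

(** The modulation has modulus one and Lebesgue measure is invariant under the
    translation. *)
Lemma tfshift_isometry z f : sq (tfshift z f) = sq f.
Proof.
have [] : (sq (tfshift z f))%:E = (sq f)%:E; last by [].
rewrite (EFin_dotL2_ae _ (tfshift_ae z f)); last exact/cmeasurable_tfshift/L2_cmeas.
by rewrite integral_tfshift ?EFin_dotL2//; exact: L2_cmeas.
Qed.

(** Tonelli's theorem for the positive and negative parts. *)
Lemma cmeasurable_cintegral {d'} {T' : measurableType d'} (h : T' * T -> C) :
  cmeasurable h -> cmeasurable (fun x => cintegral mu setT (fun t => h (x, t))).
Proof.
have main (a : T' * T -> R) : measurable_fun setT a ->
    measurable_fun setT (fun x => \int[mu]_t a (x, t)).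
  move=> ma.
  suff mE : measurable_fun setT (fun x => (\int[mu]_t (a (x, t))%:E)%E).
    exact: measurableT_comp (fine_measurable measurableT) mE.
  have mEa : measurable_fun setT (EFin \o a) by apply/measurable_EFinP.
  rewrite (_ : (fun x => _) =
    (fun x => fubini_F mu (EFin \o a)^\+%E x - fubini_F mu (EFin \o a)^\-%E x)%E).
    apply: emeasurable_funB.
      by apply: (@measurable_fun_fubini_tonelli_F _ _ _ _ _ mu (EFin \o a)^\+%E) => //;
        exact: measurable_funepos.
    by apply: (@measurable_fun_fubini_tonelli_F _ _ _ _ _ mu (EFin \o a)^\-%E) => //;
      exact: measurable_funeneg.
  apply/funext => x; rewrite integralE.
  by congr (_ - _)%E; apply: eq_integral => t _; rewrite ?funeposE ?funenegE.
by move=> [rh ih]; split; [exact: (main (Re \o h))|exact: (main (Im \o h))].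
Qed.

Lemma measurable_dot_tfshift f g :
  measurable_fun setT (fun z => abs2 (dotL2 f (tfshift z g))).
Proof.
apply: cmeasurable_abs2.
rewrite (_ : (fun z => _) = (fun z => cintegral mu setT
    (fun t => (fun p : Z * T => f p.2 * conjc (tfshift_fun p.1 g p.2)) (z, t)))).
  apply: (@cmeasurable_cintegral _ _
    (fun p : Z * T => f p.2 * conjc (tfshift_fun p.1 g p.2))).
  apply: cmeasurableM.
    exact: cmeasurable_comp (L2_cmeas f) measurable_snd.
  by apply: cmeasurableJ; apply: cmeasurable_tfshift_pair; exact: L2_cmeas.
apply/funext => z; apply: dotL2_ae.
- exact: L2_cmeas.
- exact/cmeasurable_tfshift/L2_cmeas.
- exact: aeW.
- exact: tfshift_ae.
Qed.

End tfshift.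

(** * An infinite orthonormal family *)
Section infinite_dimension.
Context {R : realType}.

Definition cube (d : nat) (a : R) : set (Euclid R d) :=
  [set t | forall i, a <= tnth t i < a + 1].
Arguments cube d a : clear implicits.

Lemma measurable_cube d a : measurable (cube d a).
Proof.
rewrite (_ : cube d a = \bigcap_(i in [set: 'I_d])
    ((fun t : Euclid R d => tnth t i) @^-1` `[a, a + 1[)).
  apply: fin_bigcap_measurable => // i _.
  by rewrite -[X in measurable X]setTI; exact: measurable_tnth.
by apply/seteqP; split => t /= ct i; have := ct i; rewrite /= in_itv/= => ->.
Qed.

Lemma lebesgue_cube d a : lebesgue_tuple R d (cube d a) = 1%E.
Proof.
elim: d => [|d IH].
  rewrite /= diracE (_ : _ \in _ = true)//.
  by apply/mem_set => -[].
rewrite /= /lebesgue_cons /pushforward.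
rewrite [X in product_measure1 _ _ X](_ : _ = `[a, a + 1[%classic `*` cube d a).
  rewrite product_measure1E//; last exact: measurable_cube.
  rewrite IH mule1; transitivity (lebesgue_measure `[a, a + 1[%classic) => //.
  rewrite lebesgue_measure_itv/= lte_fin ltrDl ltr01 -EFinB.
  by congr EFin; ring.
apply/seteqP; split => -[x t] /=.
  move=> ct; split; first by have := ct ord0; rewrite tnth0 in_itv.
  by move=> i; have := ct (lift ord0 i); rewrite tnthS.
rewrite in_itv/= => -[ax ct] i.
by case: (unliftP ord0 i) => [j ->|->]; rewrite ?tnthS ?tnth0.
Qed.

End infinite_dimension.
Arguments cube {R} d a _.

Section orthonormal_family.
Context {R : realType} {d : nat}.
Local Notation C := R[i].
Local Notation L2 := (L2 R d).
Local Notation mu := (lebesgue_tuple R d).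
Local Notation T := (Euclid R d).

Definition cindic (A : set T) (t : T) : C := (\1_A t : R)%:C.

Lemma cmeasurable_cindic (A : set T) : measurable A -> cmeasurable (cindic A).
Proof.
move=> mA; split; last exact: measurable_cst.
exact: measurable_indic.
Qed.

Lemma abs2_cindic (A : set T) t : abs2 (cindic A t) = \1_A t.
Proof. by rewrite abs2_real indicE -natrX; case: (_ \in _). Qed.

Lemma integral_cindic (A : set T) : measurable A ->
  (\int[mu]_t (abs2 (cindic A t))%:E = mu A)%E.
Proof.
move=> mA; under eq_integral do rewrite abs2_cindic.
by rewrite integral_indic// setIT.
Qed.

Lemma cindic_cube_sqint (a : R) : cindic (cube d a) \in @square_integrable R d.
Proof.
apply/square_integrableP; split; first by apply: cmeasurable_cindic; exact: measurable_cube.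
by rewrite integral_cindic ?lebesgue_cube ?ltry//; exact: measurable_cube.
Qed.

Definition cubeL2 (n : nat) : L2 := mkL2 (cindic_cube_sqint n%:R).

(** The cubes [n, n + 1)^d have measure one, and they are pairwise disjoint as soon
    as there is a coordinate to distinguish them. *)
Lemma cubeL2_orthonormal (d0 : (0 < d)%N) m n :
  dotL2 (cubeL2 m) (cubeL2 n) = (m == n)%:R.
Proof.
have mc k : cmeasurable (cindic (cube d k%:R)).
  by apply: cmeasurable_cindic; exact: measurable_cube.
have [->|mn] := eqVneq m n.
  rewrite (hdotuu L2_hilbert) /sqnorm; congr (_%:C).
  have [] : (complex.Re (dotL2 (cubeL2 n) (cubeL2 n)))%:E = 1%:E :> \bar R; last by [].
  rewrite (EFin_dotL2_ae (mc n) (mkL2E _)) integral_cindic ?lebesgue_cube//.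
  exact: measurable_cube.
rewrite (dotL2_ae (mc m) (mc n) (mkL2E _) (mkL2E _)).
rewrite (_ : (fun t => _) = fun _ => 0).
  by rewrite /cintegral /= !Rintegral_cst//= !mul0r.
apply/funext => t; rewrite /cindic.
have : ~ (cube d m%:R t /\ cube d n%:R t).
  move=> [/(_ (Ordinal d0))/andP[m1 m2] /(_ (Ordinal d0))/andP[n1 n2]].
  have := le_lt_trans m1 n2; have := le_lt_trans n1 m2.
  rewrite !natr1 !ltr_nat !ltnS => nm nm'; move: mn.
  by rewrite eqn_leq nm nm'.
rewrite !indicE; have [/set_mem h1|_] := boolP (t \in cube d m%:R); last first.
  by rewrite mul0r.
have [/set_mem h2|_] := boolP (t \in cube d n%:R); last first.
  by rewrite conjc0 mulr0.
by move=> /(_ (conj h1 h2)).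
Qed.

Lemma L2_nonzero (d0 : (0 < d)%N) : exists f : L2, f != 0.
Proof.
exists (cubeL2 0); apply/eqP => c0.
have := cubeL2_orthonormal d0 0 0.
by rewrite c0 (hdot0l L2_hilbert) eqxx => /esym/eqP; rewrite oner_eq0.
Qed.

End orthonormal_family.

(** * Bounded operators, Hilbert-Schmidt operators, rank-one operators *)
Section operators_theory.
Context {R : realType} {d : nat}.
Local Notation C := R[i].
Local Notation L2 := (L2 R d).
Local Notation dot := (@dotL2 R d).
Local Notation sq := (sqnorm (@dotL2 R d)).
Local Notation Re := (@complex.Re R).
Local Notation H := (@L2_hilbert R d).
Implicit Types (f g h phi u : L2) (T S : L2 -> L2) (a : C).

Lemma normL2E f : normL2 f ^+ 2 = sq f.
Proof. exact: (sqr_nrm H). Qed.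

Lemma bl_linear T : bounded_linear T ->
  forall a f g, T (a *: f + g) = a *: T f + T g.
Proof. by case. Qed.

Lemma bl0 T : bounded_linear T -> T 0 = 0.
Proof.
move=> bT; have := bl_linear bT (-1) 0 0.
by rewrite scaler0 addr0 scaleN1r addNr.
Qed.

Lemma blZ T : bounded_linear T -> forall a f, T (a *: f) = a *: T f.
Proof. by move=> bT a f; rewrite -[_ *: f]addr0 (bl_linear bT) (bl0 bT) addr0. Qed.

Lemma blD T : bounded_linear T -> forall f g, T (f + g) = T f + T g.
Proof. by move=> bT f g; rewrite -{1}[f]scale1r (bl_linear bT) scale1r. Qed.

Lemma bl_bound T : bounded_linear T ->
  exists2 K : R, 0 <= K & forall f, sq (T f) <= K * sq f.
Proof.
move=> [_ [M TM]]; exists (M ^+ 2); first exact: sqr_ge0.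
move=> f; rewrite -!normL2E -exprMn -[leLHS]ger0_norm ?sqr_ge0//.
rewrite normrX -[leRHS]ger0_norm ?sqr_ge0// normrX.
rewrite ler_pXn2r ?nnegrE// ger0_norm ?sqrtr_ge0//.
by rewrite (le_trans (TM f))// ler_norm.
Qed.

Lemma bl_intro T (K : R) : (forall a f g, T (a *: f + g) = a *: T f + T g) ->
  (forall f, sq (T f) <= K * sq f) -> bounded_linear T.
Proof.
move=> Tlin TK; split; first exact: Tlin.
exists (Num.sqrt `|K|) => f.
rewrite -(@ler_pXn2r _ 2) ?nnegrE ?mulr_ge0 ?sqrtr_ge0//.
rewrite exprMn !normL2E sqr_sqrtr// (le_trans (TK f))//.
by rewrite ler_wpM2r ?(sqn_ge0 H)// ler_norm.
Qed.

Lemma bl_comp T S : bounded_linear T -> bounded_linear S -> bounded_linear (T \o S).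
Proof.
move=> bT bS; have [K K0 TK] := bl_bound bT; have [L L0 SL] := bl_bound bS.
apply: (@bl_intro _ (K * L)) => [a f g|f] /=.
  by rewrite (bl_linear bS) (bl_linear bT).
by rewrite (le_trans (TK _))// -mulrA ler_wpM2l.
Qed.

Lemma adjointP T : bounded_linear T -> forall f g, dot (T f) g = dot f (adjoint T g).
Proof.
move=> bT; have [K K0 TK] := bl_bound bT.
have [S ST] := adjoint_exists H (bl_linear bT) TK.
by rewrite /adjoint; case: xgetP => [S' _ //|/(_ S)]; case.
Qed.

Lemma hdot_inj f g : (forall h, dot h f = dot h g) -> f = g.
Proof.
move=> fg; apply/eqP; rewrite -subr_eq0; apply/eqP/(hdot_eq0 H).
by rewrite (hdotBr H) fg subrr.
Qed.

(** The scalar product of T T^* f and f is |T^* f|^2, so that Cauchy-Schwarz gives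
    |T^* f|^4 <= K |T^* f|^2 |f|^2. *)
Lemma adjoint_bound T (K : R) : bounded_linear T ->
  0 <= K -> (forall f, sq (T f) <= K * sq f) ->
  forall f, sq (adjoint T f) <= K * sq f.
Proof.
move=> bT K0 TK f; have adj := adjointP bT.
have [->|/(sqn_gt0 H) Sf] := eqVneq (adjoint T f) 0.
  by rewrite (sqn0 H) mulr_ge0// (sqn_ge0 H).
rewrite -(ler_pM2l Sf).
have -> : sq (adjoint T f) * sq (adjoint T f) = abs2 (dot (T (adjoint T f)) f).
  by rewrite adj (hdotuu H) abs2_real expr2.
rewrite (le_trans (cauchy_schwarz H _ _))//.
by rewrite mulrCA mulrA ler_wpM2r ?(sqn_ge0 H).
Qed.

Lemma bl_adjoint T : bounded_linear T -> bounded_linear (adjoint T).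
Proof.
move=> bT; have [K K0 TK] := bl_bound bT; have adj := adjointP bT.
apply: (@bl_intro _ K) => [a f g|]; last exact: adjoint_bound.
apply: hdot_inj => h; rewrite -adj (hdotDr H) (hdotZr H) !adj.
by rewrite (hdotDr H) (hdotZr H).
Qed.

Lemma bl_tfshift z : bounded_linear (@tfshift R d z).
Proof.
apply: (@bl_intro _ 1) => [a f g|f]; first exact: tfshift_linear.
by rewrite mul1r /sqnorm tfshift_isometry.
Qed.

Lemma onbP : is_onb dot onb.
Proof.
have [B Bonb] := onb_exists H.
by rewrite /onb; case: xgetP => [? _ //|/(_ B)]; case.
Qed.

Lemma hs_normsqE T : hs_normsq T = (\esum_(e in onb) (sq (T e))%:E)%E.
Proof. by apply: eq_esum => e _; rewrite normL2E. Qed.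

Lemma hs_normsq_ge0 T : (0 <= hs_normsq T)%E.
Proof. by rewrite hs_normsqE esum_ge0// => e _; rewrite lee_fin (sqn_ge0 H). Qed.

Lemma hs_normE T : (hs_normsq T < +oo)%E -> ((hs_norm T) ^+ 2)%:E = hs_normsq T.
Proof.
move=> Tfin; rewrite /hs_norm sqr_sqrtr ?fineK ?fine_ge0 ?hs_normsq_ge0//.
by rewrite ge0_fin_numE// hs_normsq_ge0.
Qed.

(** The vector T^* (T f) is orthogonal to the basis, since its scalar products with
    [e] are those of [T f] with [T e]. *)
Lemma bl_eq0 T : bounded_linear T -> (forall e, onb e -> T e = 0) -> forall f, T f = 0.
Proof.
move=> bT T0 f; apply/(hdot_eq0 H); rewrite (adjointP bT).
have [_ onb0] := onbP.
suff -> : adjoint T (T f) = 0 by rewrite (hdot0r H).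
apply: onb0 => e oe; rewrite (hdotC H) -(adjointP bT) T0//.
by rewrite (hdot0l H) conjc0.
Qed.

Definition rank1 f phi : L2 -> L2 := fun g => dot g phi *: f.

Lemma bl_rank1 f phi : bounded_linear (rank1 f phi).
Proof.
apply: (@bl_intro _ (sq phi * sq f)) => [a u v|u].
  by rewrite /rank1 (hdotP H) scalerDl scalerA.
rewrite (sqnZ H) mulrAC ler_wpM2r ?(sqn_ge0 H)// [leRHS]mulrC.
exact: (cauchy_schwarz H).
Qed.

Lemma esumZl (D : set L2) (c : R) (F : L2 -> R) : 0 <= c -> (forall e, 0 <= F e) ->
  (\esum_(e in D) (F e * c)%:E = (\esum_(e in D) (F e)%:E) * c%:E)%E.
Proof.
move=> c0 F0; rewrite muleC /esum -ereal_supZl//; last first.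
  by apply/set0P; exists (\sum_(x \in set0) (F x)%:E)%E, set0 => //; exact: fsets_set0.
have sumZ X : finite_set X -> (\sum_(x \in X) (F x * c)%:E)%E =
    (c%:E * \sum_(x \in X) (F x)%:E)%E.
  move=> Xfin; rewrite !fsbig_finite//= !sumEFin -EFinM mulr_sumr.
  by congr EFin; apply: eq_bigr => e _; rewrite mulrC.
congr (ereal_sup _); apply/seteqP; split => [_ [X XD <-]|_ [_ [X XD <-] <-]].
  by exists (\sum_(x \in X) (F x)%:E)%E; [exists X|rewrite sumZ//; case: XD].
by exists X => //; rewrite sumZ//; case: XD.
Qed.

Lemma hs_normsq_rank1 f phi : hs_normsq (rank1 f phi) = (sq phi * sq f)%:E.
Proof.
rewrite hs_normsqE EFinM -(parseval H onbP) -esumZl ?(sqn_ge0 H)//; last first.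
  by move=> e; exact: abs2_ge0.
by apply: eq_esum => e _; rewrite (sqnZ H) (hdotC H e phi) abs2J.
Qed.

Lemma hs_rank1 f phi : hilbert_schmidt (rank1 f phi).
Proof. by split; [exact: bl_rank1|rewrite hs_normsq_rank1 ltry]. Qed.

Lemma rank1_neq0 f phi : f != 0 -> phi != 0 -> rank1 f phi != 0.
Proof.
move=> f0 p0; apply/eqP => /(congr1 (fun T => T phi)); rewrite /rank1 => /eqP.
rewrite -[X in _ == X]/(0 : L2) scaler_eq0 (negbTE f0) orbF (hdotuu H).
by rewrite eq_complex /= gt_eqF// (sqn_gt0 H).
Qed.

Lemma rank_one_rank1 f phi : f != 0 -> phi != 0 -> rank_one (rank1 f phi).
Proof.
move=> f0 p0; exists f => //; apply/seteqP; split => [_ [g _ <-]|_ [a _ <-]].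
  by exists (dot g phi).
have pp : dot phi phi != 0.
  by rewrite (hdotuu H) eq_complex /= gt_eqF// (sqn_gt0 H).
by exists ((a / dot phi phi) *: phi) => //; rewrite /rank1 (hdotZl H) divfK.
Qed.

Lemma rank_one_neq0 T : rank_one T -> T != 0.
Proof.
move=> [f f0 Tf]; apply: contra f0 => /eqP T0.
have : [set a *: f | a in [set: C]] f by exists 1 => //; rewrite scale1r.
by rewrite -Tf T0 => -[g _ <-].
Qed.

(** Moving [T] to the other side by its adjoint, the sum over the basis becomes the
    Parseval expansion of the scalar product of [phi] and T^* u. *)
Lemma hs_dot_rank1r T u phi : bounded_linear T ->
  hs_dot T (rank1 u phi) = dot (T phi) u.
Proof.
move=> bT; rewrite (adjointP bT) -(csum_parseval H onbP); congr csum.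
apply/funext => e; rewrite /rank1 (hdotZr H) -(hdotC H) (adjointP bT).
by rewrite -(hdotC H).
Qed.

Lemma hs_dot_rank1l S h phi : bounded_linear S ->
  hs_dot (rank1 h phi) S = dot h (S phi).
Proof.
move=> bS; rewrite (hdotC H) (adjointP bS) -(hdotC H) -(csum_parseval H onbP).
congr csum; apply/funext => e; rewrite /rank1 (hdotZl H) -(hdotC H) mulrC.
by rewrite (hdotC H (S e)) (adjointP bS) -(hdotC H).
Qed.

(** * Eigenvectors of the two localization operators *)
Section eigenvectors.
Variables (gamma : L2 -> L2) (Omega : set (Euclid R d * Euclid R d)).
Hypothesis bgamma : bounded_linear gamma.

Definition locop_at z : L2 -> L2 :=
  tfshift z \o gamma \o adjoint gamma \o adjoint (tfshift z).

Lemma bl_locop_at z : bounded_linear (locop_at z).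
Proof.
apply: bl_comp; last exact/bl_adjoint/bl_tfshift.
apply: bl_comp; last exact/bl_adjoint.
by apply: bl_comp => //; exact: bl_tfshift.
Qed.

(** The operators in the integrand compose on the left, hence act only on the
    vector [f] of the rank-one operator, and the pairing of a rank-one operator
    with [S] is the pairing of that vector with [S phi]. *)
Lemma locop_rank1 f h phi :
  locop_L2 gamma Omega f h -> locop_HS gamma Omega (rank1 f phi) (rank1 h phi).
Proof.
move=> [_ fh]; split=> [|S [bS _]]; first exact: hs_rank1.
have -> : (fun z => hs_dot (tfshift z \o gamma \o stft_op gamma (rank1 f phi) z) S) =
    (fun z => dot (tfshift z (gamma (stft gamma f z))) (S phi)).
  apply/funext => z.
  have -> : tfshift z \o gamma \o stft_op gamma (rank1 f phi) z =
      rank1 (tfshift z (gamma (stft gamma f z))) phi.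
    by apply/funext => g; exact: (blZ (bl_locop_at z) (dot g phi) f).
  exact: hs_dot_rank1l.
by rewrite hs_dot_rank1l//; exact: fh.
Qed.

(** Testing the weak integral in the space of Hilbert-Schmidt operators against
    rank-one operators [rank1 u phi] gives the weak integral tested against [u]. *)
Lemma locop_apply rho T phi : bounded_linear rho ->
  locop_HS gamma Omega rho T -> locop_L2 gamma Omega (rho phi) (T phi).
Proof.
move=> brho [[bT _] rhoT]; split => // u _.
have [] := rhoT _ (hs_rank1 u phi).
have -> : (fun z => hs_dot (tfshift z \o gamma \o stft_op gamma rho z) (rank1 u phi)) =
    (fun z => dot (tfshift z (gamma (stft gamma (rho phi) z))) u).
  apply/funext => z.
  have bF : bounded_linear (tfshift z \o gamma \o stft_op gamma rho z).
    exact: (bl_comp (bl_locop_at z) brho).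
  exact: (hs_dot_rank1r _ _ bF).
by rewrite hs_dot_rank1r.
Qed.

Lemma rank1Z a f phi : rank1 (a *: f) phi = a *: rank1 f phi.
Proof. by apply/funext => g; rewrite /rank1 fctE !scalerA mulrC. Qed.

Lemma eigen_rank1 a f phi :
  op_eigenspace setT (locop_L2 gamma Omega) a f ->
  op_eigenspace (@hilbert_schmidt R d) (locop_HS gamma Omega) a (rank1 f phi).
Proof.
by move=> [_ fa]; split; [exact: hs_rank1|rewrite -rank1Z; exact: locop_rank1].
Qed.

Lemma eigen_apply a rho phi :
  op_eigenspace (@hilbert_schmidt R d) (locop_HS gamma Omega) a rho ->
  op_eigenspace setT (locop_L2 gamma Omega) a (rho phi).
Proof. by move=> [[brho _] rhoa]; split => //; exact: locop_apply brho rhoa. Qed.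

Lemma neq0_fun rho : rho != 0 :> (L2 -> L2) -> exists phi, rho phi != 0.
Proof.
move=> rho0; apply: contrapT => /forallNP rho_eq0; move/eqP: rho0; apply.
by apply/funext => phi; apply/eqP/negPn/negP; exact: rho_eq0.
Qed.

Lemma same_eigenvalues (d0 : (0 < d)%N) a :
  op_eigenvalue setT (locop_L2 gamma Omega) a <->
  op_eigenvalue (@hilbert_schmidt R d) (locop_HS gamma Omega) a.
Proof.
split=> [[f [f0 fa]]|[rho [/neq0_fun[phi rphi] rhoa]]].
  have [phi phi0] := @L2_nonzero R d d0.
  by exists (rank1 f phi); split; [exact: rank1_neq0|exact: eigen_rank1].
by exists (rho phi); split => //; exact: eigen_apply.
Qed.

(** One eigenvector [f] on functions gives the eigenvectors [rank1 f phi], with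
    [phi] in an infinite orthonormal family. *)
Lemma infinite_multiplicity (d0 : (0 < d)%N) a :
  op_eigenvalue (@hilbert_schmidt R d) (locop_HS gamma Omega) a ->
  forall n, dim_ge (op_eigenspace (@hilbert_schmidt R d) (locop_HS gamma Omega) a) n.
Proof.
move=> /(same_eigenvalues d0)[f [f0 fa]] n.
exists (fun i : 'I_n => rank1 f (cubeL2 i)); split => [i|c csum0 i].
  exact: eigen_rank1.
have : (\sum_(i < n) c i *: rank1 f (@cubeL2 R d i)) (cubeL2 i) = 0.
  by rewrite csum0.
have E j : (c j *: rank1 f (@cubeL2 R d j)) (cubeL2 i) = (c j * (i == j)%:R) *: f.
  rewrite -[LHS]/(c j *: (dot (cubeL2 i) (cubeL2 j) *: f)).
  by rewrite cubeL2_orthonormal// scalerA.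
rewrite fct_sumE (bigD1 i)//= big1 => [|j ji]; last first.
  by rewrite E eq_sym (negbTE ji) mulr0 scale0r.
rewrite addr0 E eqxx mulr1 => /eqP.
by rewrite scaler_eq0 (negbTE f0) orbF => /eqP.
Qed.

(** All values of an eigenvector [rho] are eigenvectors on functions or zero; if
    these form a line, then so does the range of [rho]. *)
Lemma eigenvector_rank_one a rho :
  op_eigenvector (@hilbert_schmidt R d) (locop_HS gamma Omega) a rho ->
  ~ dim_ge (op_eigenspace setT (locop_L2 gamma Omega) a) 2 -> rank_one rho.
Proof.
move=> [rho0 rhoa] dim1.
have [[brho _] _] := rhoa.
have [phi rphi] := neq0_fun rho0.
exists (rho phi) => //; apply/seteqP; split => [_ [g _ <-]|_ [b _ <-]]; last first.
  by exists (b *: phi) => //; rewrite (blZ brho).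
apply: contrapT => hg; apply: dim1.
exists (fun i : 'I_2 => if i == ord0 then rho phi else rho g); split.
  by move=> i; case: ifP => _; exact: eigen_apply.
move=> c; rewrite big_ord_recl big_ord1 /= => c0.
have c1 : c (lift ord0 ord0) = 0.
  apply/eqP/negPn/negP => c1; apply: hg.
  exists (- (c ord0 / c (lift ord0 ord0))) => //.
  have := congr1 (fun x => (c (lift ord0 ord0))^-1 *: x) c0.
  rewrite scaler0 scalerDr !scalerA mulVf// scale1r => /eqP.
  by rewrite addrC addr_eq0 => /eqP ->; rewrite scaleNr mulrC.
have c00 : c ord0 = 0.
  move/eqP: c0; rewrite c1 scale0r addr0 scaler_eq0 (negbTE rphi) orbF.
  by move/eqP.
by move=> i; case: (unliftP ord0 i) => [j ->|->//]; rewrite (ord1 j).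
Qed.

End eigenvectors.
End operators_theory.

(** * Countable sums and integrals *)
Section countable_sums.
Context {R : realType} {I : choiceType}.
Implicit Types (D : set I).

(** For each [n], only finitely many terms of a finite sum exceed 1/(n+1). *)
Lemma summable_countable D (a : I -> R) : (forall i, 0 <= a i) ->
  (\esum_(i in D) (a i)%:E < +oo)%E -> countable (D `&` [set i | a i != 0]).
Proof.
move=> a0 afin.
pose B n := D `&` [set i | natSinv n < a i].
rewrite (_ : _ `&` _ = \bigcup_n B n).
  apply: bigcup_countable => // n _; apply: finite_set_countable.
  apply: contrapT => Binf.
  have Ea : ((fine (\esum_(i in D) (a i)%:E))%:E = \esum_(i in D) (a i)%:E)%E.
    by rewrite fineK// ge0_fin_numE// esum_ge0// => i _; rewrite lee_fin.
  pose m := (Num.trunc (fine (\esum_(i in D) (a i)%:E)%E * n.+1%:R)).+1.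
  have [X XB mX] := infinite_set_fset m Binf.
  have : ((\sum_(i \in [set` X]) (a i)%:E)%R <= \esum_(i in D) (a i)%:E)%E.
    apply: esum_ge; exists [set` X] => //; split; first exact: finite_fset.
    by move=> i /XB[].
  rewrite -Ea fsbig_finite//= set_fsetK sumEFin lee_fin leNgt => /negP; apply.
  apply: (@lt_le_trans _ _ (m%:R * natSinv n)).
    by rewrite /natSinv ltr_pdivlMr// /m truncnS_gt.
  apply: (@le_trans _ _ ((size X)%:R * natSinv n)).
    by rewrite ler_wpM2r ?ler_nat// ltW// natSinv_gt0.
  have -> : (size X)%:R * natSinv n = \sum_(i <- X) natSinv n :> R.
    by rewrite big_const_seq count_predT iter_addr_0 mulr_natl.
  rewrite big_seq [leRHS]big_seq; apply: ler_sum => i iX.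
  by have [_ /ltW] := XB _ iX.
apply/seteqP; split => [i [Di /= ai]|i [n _ [Di /= ni]]]; last first.
  by split => //=; rewrite gt_eqF// (lt_trans _ ni)// natSinv_gt0.
have ai0 : 0 < a i by rewrite lt_neqAle eq_sym ai a0.
by have [N HN] := natSinv_lt ai0; exists N => //; split => //; exact: HN.
Qed.

(** The index [i0] is the value of the enumeration outside [Q]. *)
Lemma esum_enum (i0 : I) D : countable D -> exists (Q : set nat) (g : nat -> I),
  (forall j, Q j -> D (g j)) /\
  forall a : I -> \bar R, (forall i, D i -> (0 <= a i)%E) ->
  (\esum_(i in D) a i = \sum_(0 <= j <oo | j \in Q) a (g j))%E.
Proof.
move=> /countable_injP[f finj].
pose g j := xget i0 [set i | D i /\ f i = j].
have fg i : D i -> g (f i) = i.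
  move=> Di; rewrite /g; case: xgetP => [k _ [Dk fk]|/(_ i)]; last by case.
  by apply: finj => //; rewrite inE.
exists (f @` D), g; split => [_ [i Di <-]|a a0]; first by rewrite fg.
rewrite nneseries_esum => [|j]; last by rewrite inE => -[i Di <-]; rewrite fg// a0.
rewrite (_ : [set x | x \in f @` D] = f @` D); last first.
  by apply/seteqP; split => j /=; rewrite inE.
rewrite (@reindex_esum _ _ _ D (f @` D) f).
  by apply: eq_esum => i Di; rewrite fg.
split; [|exact: finj|] => j //.
Qed.

End countable_sums.

Lemma integral_parallelogram {dT} {T : measurableType dT} {R : realType}
    (mu : {measure set T -> \bar R}) (D : set T) (a b c e : T -> R) :
    measurable D ->
    measurable_fun D (fun z => (a z)%:E) -> measurable_fun D (fun z => (b z)%:E) ->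
    measurable_fun D (fun z => (c z)%:E) -> measurable_fun D (fun z => (e z)%:E) ->
    (forall z, D z -> 0 <= a z) -> (forall z, D z -> 0 <= b z) ->
    (forall z, D z -> 0 <= c z) -> (forall z, D z -> 0 <= e z) ->
    (forall z, a z + b z = 2 * c z + 2 * e z) ->
  (\int[mu]_(z in D) (a z)%:E + \int[mu]_(z in D) (b z)%:E =
   2%:E * \int[mu]_(z in D) (c z)%:E + 2%:E * \int[mu]_(z in D) (e z)%:E)%E.
Proof.
move=> mD ma mb mc me a0 b0 c0 e0 abce.
rewrite -!ge0_integralZl// -!ge0_integralD//.
- by apply: eq_integral => z _; rewrite -!EFinM -!EFinD abce.
- by move=> z Dz; rewrite mule_ge0// lee_fin c0.
- exact: measurable_funeM.
- by move=> z Dz; rewrite mule_ge0// lee_fin e0.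
- exact: measurable_funeM.
Qed.

Lemma fine_parallelogram {R : realType} (x y z w : \bar R) :
    x \is a fin_num -> y \is a fin_num -> z \is a fin_num -> w \is a fin_num ->
    (x + y = 2%:E * z + 2%:E * w)%E ->
  fine x + fine y = 2 * fine z + 2 * fine w.
Proof. by case: x y z w => [x| |] [y| |] [z| |] [w| |]//= _ _ _ _ []. Qed.

Section integral_countable_sum.
Context {dT} {T : measurableType dT} {R : realType} {I : choiceType}.
Variable mu : {measure set T -> \bar R}.
Variables (i0 : I) (D D0 : set I) (F : I -> T -> \bar R).
Hypotheses (cD0 : countable D0) (F0 : forall i t, D i -> ~ D0 i -> F i t = 0%E).
Hypotheses (Fge0 : forall i t, (0 <= F i t)%E).
Hypothesis mF : forall i, measurable_fun setT (F i).

Let esum_restrict (a : I -> \bar R) : (forall i, 0 <= a i)%E ->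
  (forall i, D i -> ~ D0 i -> a i = 0%E) ->
  (\esum_(i in D) a i = \esum_(i in D `&` D0) a i)%E.
Proof.
move=> a0 aD; rewrite (esumID D0)// [X in (_ + X)%E]esum1 ?adde0//.
by move=> i [Di Di0]; exact: aD.
Qed.

Let cDD0 : countable (D `&` D0).
Proof. by apply: sub_countable cD0; apply: subset_card_le; exact: subIsetr. Qed.

Lemma measurable_esum : measurable_fun setT (fun t => \esum_(i in D) F i t)%E.
Proof.
have [Q [g [_ QE]]] := @esum_enum R I i0 _ cDD0.
under eq_fun => t.
  rewrite esum_restrict//; last by move=> i Di Di0; exact: F0.
  rewrite QE//.
  over.
exact: ge0_emeasurable_sum.
Qed.

(** The index set may be uncountable, but all terms vanish outside the countable
    set [D0], so that this is the exchange of an integral and a series. *)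
Lemma integral_esum (E : set T) : measurable E ->
  (\int[mu]_(t in E) (\esum_(i in D) F i t) =
    \esum_(i in D) (\int[mu]_(t in E) F i t))%E.
Proof.
move=> mE; have [Q [g [_ QE]]] := @esum_enum R I i0 _ cDD0.
rewrite esum_restrict; last 2 first.
- by move=> i; exact: integral_ge0.
- by move=> i Di Di0; apply: integral0_eq => t _; exact: F0.
rewrite QE; last by move=> i _; exact: integral_ge0.
under eq_integral => t _.
  rewrite esum_restrict//; last by move=> i Di Di0; exact: F0.
  rewrite QE// eseries_mkcond.
  over.
rewrite (@integral_nneseries _ _ _ mu E mE
  (fun j t => if j \in Q then F (g j) t else 0%E)).
- rewrite [RHS]eseries_mkcond; apply: eq_eseriesr => j _.
  by case: ifP => // _; rewrite integral0.
- move=> j; case: (j \in Q); last exact: measurable_cst.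
  exact: measurable_funS (mF (g j)).
- by move=> j t _; case: ifP.
Qed.

End integral_countable_sum.

(** * Energy in a region of phase space *)
Section energy.
Context {R : realType} {d : nat}.
Local Notation C := R[i].
Local Notation L2 := (L2 R d).
Local Notation Z := (Euclid R d * Euclid R d)%type.
Local Notation dot := (@dotL2 R d).
Local Notation sq := (sqnorm (@dotL2 R d)).
Local Notation H := (@L2_hilbert R d).
Local Notation leb := (@lebesgue_phase R d).
Variable gamma : L2 -> L2.
Hypothesis hgamma : hilbert_schmidt gamma.
Implicit Types (f g h phi u : L2) (z : Z) (D : set Z) (rho : L2 -> L2).

Let bgamma : bounded_linear gamma. Proof. by case: hgamma. Qed.

Lemma stft_bl z : bounded_linear (fun f => stft gamma f z).
Proof.
exact: (bl_comp (bl_adjoint bgamma) (bl_adjoint (bl_tfshift z))).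
Qed.

Lemma hs_countable rho : hilbert_schmidt rho ->
  countable (onb `&` [set e | sq (rho e) != 0]).
Proof.
move=> [_]; rewrite hs_normsqE; apply: summable_countable => e.
exact: (sqn_ge0 H).
Qed.

Lemma hs_vanish rho e : onb e -> ~ (onb `&` [set e | sq (rho e) != 0]) e -> rho e = 0.
Proof.
move=> oe he; apply: (hdot_eq0 H); apply/eqP/negPn/negP => re0.
by apply: he; split.
Qed.

(** Parseval's identity for gamma^* pi(z)^* f, whose scalar product with [e] is the
    one of [f] with pi(z) (gamma e). *)
Lemma sq_stft f z : ((sq (stft gamma f z))%:E =
  \esum_(e in onb) (abs2 (dot f (tfshift z (gamma e))))%:E)%E.
Proof.
rewrite -(parseval H onbP); apply: eq_esum => e _; congr EFin.
rewrite -abs2J -(hdotC H) /stft -(adjointP bgamma) -(adjointP (bl_tfshift z)).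
by rewrite (hdotC H) abs2J.
Qed.

Lemma measurable_sq_stft f : measurable_fun setT (fun z => (sq (stft gamma f z))%:E).
Proof.
under eq_fun do rewrite sq_stft.
apply: (@measurable_esum _ _ _ _ (0 : L2) onb _
  (fun e z => (abs2 (dot f (tfshift z (gamma e))))%:E) (hs_countable hgamma)).
- move=> e z oe /(hs_vanish oe) ->.
  by rewrite (bl0 (bl_tfshift z)) (hdot0r H) abs20.
- by move=> e z; rewrite lee_fin abs2_ge0.
- by move=> e; apply/measurable_EFinP; exact: measurable_dot_tfshift.
Qed.

Lemma sq_stft_le : exists2 K : R, 0 <= K & forall f z, sq (stft gamma f z) <= K * sq f.
Proof.
have [K K0 gK] := bl_bound bgamma; exists K => // f z.
rewrite /stft (le_trans (adjoint_bound bgamma K0 gK _))// ler_wpM2l//.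
rewrite -[leRHS]mul1r; apply: adjoint_bound => //; first exact: bl_tfshift.
by move=> g; rewrite mul1r /sqnorm tfshift_isometry.
Qed.

(** The numerator of the quotient on functions. *)
Definition energy D f : \bar R := (\int[leb]_(z in D) (sq (stft gamma f z))%:E)%E.

Lemma energy_ge0 D f : (0 <= energy D f)%E.
Proof. by apply: integral_ge0 => z _; rewrite lee_fin (sqn_ge0 H). Qed.

Let mstft D f : measurable_fun D (fun z => (sq (stft gamma f z))%:E).
Proof. exact: measurable_funTS (measurable_sq_stft f). Qed.

Let stft_ge0 f z : (0 <= (sq (stft gamma f z))%:E)%E.
Proof. by rewrite lee_fin (sqn_ge0 H). Qed.

Lemma energyZ D a f : measurable D ->
  energy D (a *: f) = ((abs2 a)%:E * energy D f)%E.
Proof.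
move=> mD; rewrite /energy -ge0_integralZl//; last by rewrite lee_fin abs2_ge0.
by apply: eq_integral => z _; rewrite (blZ (stft_bl z)) (sqnZ H) EFinM.
Qed.

Lemma energy_parallelogram D f g : measurable D ->
  (energy D (f + g)%R + energy D (f - g)%R = 2%:E * energy D f + 2%:E * energy D g)%E.
Proof.
move=> mD.
have V0 h z : D z -> 0 <= sq (stft gamma h z) by move=> _; exact: (sqn_ge0 H).
have par z : sq (stft gamma (f + g) z) + sq (stft gamma (f - g) z) =
    2 * sq (stft gamma f z) + 2 * sq (stft gamma g z).
  have -> : stft gamma (f + g) z = stft gamma f z + stft gamma g z.
    exact: (blD (stft_bl z)).
  have -> : stft gamma (f - g) z = stft gamma f z - stft gamma g z.
    by rewrite (blD (stft_bl z)) -[- g]scaleN1r (blZ (stft_bl z)) scaleN1r.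
  exact: (parallelogram H).
apply: (integral_parallelogram leb mD (mstft (f + g)) (mstft (f - g)) (mstft f) (mstft g)
  (V0 (f + g)) (V0 (f - g)) (V0 f) (V0 g) par).
Qed.

Lemma energy_bound : exists2 K : R, 0 <= K & forall D f, measurable D ->
  (energy D f <= (K * sq f)%:E * leb D)%E.
Proof.
have [K K0 VK] := sq_stft_le; exists K => // D f mD.
rewrite -integral_cst//; apply: ge0_le_integral => //.
by move=> z _; rewrite lee_fin.
Qed.

Lemma energy_fin D f : measurable D -> (leb D < +oo)%E -> energy D f \is a fin_num.
Proof.
move=> mD Dfin; have [K K0 EK] := energy_bound.
rewrite ge0_fin_numE ?energy_ge0// (le_lt_trans (EK D f mD))//.
by rewrite lte_mul_pinfty// ?lee_fin ?mulr_ge0// (sqn_ge0 H).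
Qed.

Lemma fine_energy_parallelogram D f g : measurable D -> (leb D < +oo)%E ->
  fine (energy D (f + g)) + fine (energy D (f - g)) =
  2 * fine (energy D f) + 2 * fine (energy D g).
Proof.
move=> mD Dfin; have Efin h := energy_fin h mD Dfin.
exact: (fine_parallelogram (Efin (f + g)) (Efin (f - g)) (Efin f) (Efin g)
  (energy_parallelogram f g mD)).
Qed.

Lemma energy_quadratic D : measurable D -> (leb D < +oo)%E ->
  exists K, quadratic_seminorm dot (fine \o energy D) K.
Proof.
move=> mD Dfin; have [K K0 EK] := energy_bound.
have Efin f := energy_fin f mD Dfin.
have lebfin : leb D \is a fin_num by rewrite ge0_fin_numE.
exists (K * fine (leb D)); split => [f|f g|a f|f] /=.
- by rewrite fine_ge0// energy_ge0.
- rewrite -(fine_energy_parallelogram f g mD Dfin) lerDl.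
  by rewrite fine_ge0// energy_ge0.
- by rewrite energyZ// fineM.
- rewrite -lee_fin fineK// (le_trans (EK D f mD))//.
  by rewrite mulrAC [leRHS]EFinM fineK.
Qed.

Lemma esum_seq_sum (B : set L2) (s : seq L2) (F : L2 -> L2 -> R) :
  (forall u e, 0 <= F u e) ->
  (\sum_(u <- s) \esum_(e in B) (F u e)%:E = \esum_(e in B) (\sum_(u <- s) F u e)%:E)%E.
Proof.
move=> F0; elim: s => [|u s IH].
  by rewrite big_nil esum1// => e _; rewrite big_nil.
rewrite big_cons IH -esumD.
- by apply: eq_esum => e _; rewrite big_cons EFinD.
- by move=> e _; rewrite lee_fin.
- by move=> e _; rewrite lee_fin sumr_ge0.
Qed.

(** This is the estimate of the trace of the localization operator. For fixed [z]
    and [e], Bessel's inequality bounds the sum over [u] of the squared scalar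
    products of [u] with pi(z) (gamma e) by |gamma e|^2. *)
Lemma energy_trace D (s : seq L2) : measurable D -> uniq s ->
  orthonormal_set dot [set` s] ->
  (\sum_(u <- s) energy D u <= hs_normsq gamma * leb D)%E.
Proof.
move=> mD us son; rewrite /energy -ge0_integral_sum//.
rewrite -integral_cst ?hs_normsq_ge0//; apply: ge0_le_integral => //.
- by move=> z _; rewrite sume_ge0.
- exact: emeasurable_sum.
- move=> z _; under eq_bigr do rewrite sq_stft.
  rewrite esum_seq_sum; last by move=> *; exact: abs2_ge0.
  rewrite hs_normsqE; apply: le_esum => e _; rewrite lee_fin.
  have -> : sq (gamma e) = sq (tfshift z (gamma e)) by rewrite /sqnorm tfshift_isometry.
  under eq_bigr do rewrite (hdotC H) abs2J.
  exact: (bessel H son us).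
Qed.

Lemma stft_op_hs rho z : hilbert_schmidt rho -> (hs_normsq (stft_op gamma rho z) < +oo)%E.
Proof.
move=> [_ rhofin]; have [K K0 VK] := sq_stft_le.
rewrite hs_normsqE; apply: (@le_lt_trans _ _ (\esum_(e in onb) (sq (rho e) * K)%:E)%E).
  by apply: le_esum => e _; rewrite lee_fin mulrC; exact: VK.
rewrite esumZl//; last by move=> e; exact: (sqn_ge0 H).
by rewrite -hs_normsqE muleC lte_mul_pinfty.
Qed.

(** The operator gamma^* pi(z)^* rho maps [e] to gamma^* pi(z)^* (rho e), so that
    its squared Hilbert-Schmidt norm is a sum over the basis. Only countably many
    [rho e] are nonzero because [rho] is Hilbert-Schmidt. *)
Lemma energy_HS D rho : measurable D -> hilbert_schmidt rho ->
  (\int[leb]_(z in D) ((hs_norm (stft_op gamma rho z)) ^+ 2)%:E =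
   \esum_(e in onb) energy D (rho e))%E.
Proof.
move=> mD hrho.
under eq_integral => z _ do rewrite hs_normE ?stft_op_hs// hs_normsqE.
rewrite (@integral_esum _ _ _ _ leb (0 : L2) onb _
  (fun e z => (sq (stft gamma (rho e) z))%:E) (hs_countable hrho))//.
move=> e z oe /(hs_vanish oe) ->.
by rewrite (bl0 (stft_bl z)) (sqn0 H).
Qed.

Lemma energy_rank1 D f phi : sq phi = 1 ->
  (\int[leb]_(z in D) ((hs_norm (stft_op gamma (rank1 f phi) z)) ^+ 2)%:E =
   energy D f)%E.
Proof.
move=> phi1; apply: eq_integral => z _.
have -> : stft_op gamma (rank1 f phi) z = rank1 (stft gamma f z) phi.
  by apply/funext => g; exact: (blZ (stft_bl z) (dot g phi) f).
by rewrite hs_normE hs_normsq_rank1 phi1 mul1r ?ltry.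
Qed.

End energy.

(** * Suprema and maximizers *)
Section extremal_energy.
Context {R : realType} {d : nat}.
Hypothesis d0 : (0 < d)%N.
Local Notation C := R[i].
Local Notation L2 := (L2 R d).
Local Notation Z := (Euclid R d * Euclid R d)%type.
Local Notation dot := (@dotL2 R d).
Local Notation sq := (sqnorm (@dotL2 R d)).
Local Notation H := (@L2_hilbert R d).
Local Notation leb := (@lebesgue_phase R d).
Variable gamma : L2 -> L2.
Hypothesis hgamma : hilbert_schmidt gamma.
Variable Omega : set Z.
Hypothesis mOmega : measurable Omega.
Implicit Types (f g h phi u : L2) (z : Z) (D : set Z) (rho : L2 -> L2).
Local Notation energy := (energy gamma).
Local Notation supL2 := (sup_quotient_L2 gamma Omega).
Local Notation supHS := (sup_quotient_HS gamma Omega).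

Let phi0 : L2 := cubeL2 0.

Let sq_phi0 : sq phi0 = 1.
Proof. by rewrite /sqnorm cubeL2_orthonormal// eqxx. Qed.

Let phi0_neq0 : phi0 != 0.
Proof. by apply/eqP => p0; move: sq_phi0; rewrite p0 (sqn0 H) => /esym/eqP; rewrite oner_eq0. Qed.

Lemma quotient_L2E f : quotient_L2 gamma Omega f = (energy Omega f / (sq f)%:E)%E.
Proof.
rewrite /quotient_L2 normL2E; congr (_ / _)%E.
by apply: eq_integral => z _; rewrite normL2E.
Qed.

(** With a unit vector [phi0], the map from [f] to [rank1 f phi0] preserves
    numerators and denominators. *)
Lemma quotient_HS_rank1 f :
  quotient_HS gamma Omega (rank1 f phi0) = quotient_L2 gamma Omega f.
Proof.
rewrite quotient_L2E /quotient_HS energy_rank1//; congr (_ / _)%E.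
by rewrite hs_normE hs_normsq_rank1 sq_phi0 mul1r ?ltry.
Qed.

Lemma le_quotient_L2 f (x : \bar R) : f != 0 ->
  (quotient_L2 gamma Omega f <= x)%E = (energy Omega f <= x * (sq f)%:E)%E.
Proof.
move=> f0; rewrite quotient_L2E -[((sq f)%:E)^-1%E]/(inve (sq f)%:E).
by rewrite inver gt_eqF ?(sqn_gt0 H)// lee_pdivrMr// (sqn_gt0 H).
Qed.

Lemma supL2_ge0 : (0 <= supL2)%E.
Proof.
apply: (@le_trans _ _ (quotient_L2 gamma Omega phi0)).
  by rewrite quotient_L2E sq_phi0 inver oner_eq0 invr1 mule1 energy_ge0.
by apply: ereal_sup_ubound; exists phi0.
Qed.

Lemma energy_le_sup f : (energy Omega f <= supL2 * (sq f)%:E)%E.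
Proof.
have [->|f0] := eqVneq f 0.
  rewrite (sqn0 H) mule0 -(scale0r (0 : L2)) energyZ// abs20 mul0e//.
by rewrite -le_quotient_L2//; apply: ereal_sup_ubound; exists f.
Qed.

Lemma hs_normsq_gt0 rho : hilbert_schmidt rho -> rho != 0 -> (0 < hs_normsq rho)%E.
Proof.
move=> [brho _] rho0; rewrite lt_neqAle hs_normsq_ge0 andbT eq_sym.
apply: contra rho0 => /eqP hs0; apply/eqP/funext => f.
apply: (bl_eq0 brho) => e oe; apply/(hdot_eq0 H)/eqP.
have : ((sq (rho e))%:E <= hs_normsq rho)%E.
  rewrite hs_normsqE; apply: esum_ge; exists [set e]; last by rewrite fsbig_set1.
  by split => // _ ->.
by rewrite hs0 lee_fin => re; rewrite eq_le re (sqn_ge0 H).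
Qed.

Lemma quotient_HSE rho : hilbert_schmidt rho -> quotient_HS gamma Omega rho =
  ((\esum_(e in onb) energy Omega (rho e)) / hs_normsq rho)%E.
Proof.
move=> hrho; rewrite /quotient_HS energy_HS// hs_normE//.
by case: hrho.
Qed.

Lemma hs_normsq_EFin rho : hilbert_schmidt rho -> rho != 0 ->
  exists2 r : R, 0 < r & hs_normsq rho = r%:E.
Proof.
move=> hrho rho0; have hp := hs_normsq_gt0 hrho rho0; case: hrho => _.
by case: (hs_normsq rho) hp => [r| |]// r0 _; exists r.
Qed.

Lemma esum_energy_le rho (s : R) : supL2 = s%:E -> hilbert_schmidt rho ->
  (\esum_(e in onb) energy Omega (rho e) <= s%:E * hs_normsq rho)%E.
Proof.
move=> supE hrho; have s0 : 0 <= s by rewrite -lee_fin -supE supL2_ge0.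
rewrite muleC hs_normsqE -esumZl//; last by move=> e; exact: (sqn_ge0 H).
apply: le_esum => e _; rewrite EFinM muleC -supE; exact: energy_le_sup.
Qed.

Lemma quotient_HS_le rho : hilbert_schmidt rho -> rho != 0 ->
  (quotient_HS gamma Omega rho <= supL2)%E.
Proof.
move=> hrho rho0; have [supy|supfin] := eqVneq supL2 +oo%E.
  by rewrite supy leey.
have supE : supL2 = (fine supL2)%:E.
  by rewrite fineK// ge0_fin_numE ?supL2_ge0// ltey.
have [r r0 rE] := hs_normsq_EFin hrho rho0.
rewrite quotient_HSE// rE inver gt_eqF// lee_pdivrMr// -rE supE.
exact: esum_energy_le.
Qed.

(** Both the numerator and the denominator on Hilbert-Schmidt operators are sums
    over the basis of those on functions, whence one inequality; rank-one operators
    give the other one. *)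
Lemma sup_HS_L2 : supHS = supL2.
Proof.
apply/eqP; rewrite eq_le; apply/andP; split.
  by apply: ge_ereal_sup => _ [rho [hrho rho0] <-]; exact: quotient_HS_le.
apply: ge_ereal_sup => _ [f f0 <-]; rewrite -quotient_HS_rank1.
apply: ereal_sup_ubound; exists (rank1 f phi0); last by [].
by split; [exact: hs_rank1|exact: rank1_neq0].
Qed.

Lemma sup_rank_one : ereal_sup [set quotient_HS gamma Omega rho
    | rho in [set rho | hilbert_schmidt rho /\ rank_one rho]] = supHS.
Proof.
rewrite sup_HS_L2; apply/eqP; rewrite eq_le; apply/andP; split.
  apply: ge_ereal_sup => _ [rho [hrho r1] <-]; apply: quotient_HS_le => //.
  exact: rank_one_neq0.
apply: ge_ereal_sup => _ [f f0 <-]; rewrite -quotient_HS_rank1.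
apply: ereal_sup_ubound; exists (rank1 f phi0); last by [].
by split; [exact: hs_rank1|exact: rank_one_rank1].
Qed.

(** Equality of the suprema turns a maximizer [f] on functions into the rank-one
    maximizer [rank1 f phi0]. *)
Lemma attained_rank_one f : f != 0 -> (supL2 * (sq f)%:E <= energy Omega f)%E ->
  exists rho, [/\ hilbert_schmidt rho, rank_one rho &
    quotient_HS gamma Omega rho = supHS].
Proof.
move=> f0 fmax; exists (rank1 f phi0); split.
- exact: hs_rank1.
- exact: rank_one_rank1.
rewrite quotient_HS_rank1 sup_HS_L2; apply/eqP; rewrite eq_le; apply/andP; split.
  by apply: ereal_sup_ubound; exists f.
rewrite quotient_L2E inver gt_eqF ?(sqn_gt0 H)//.
by rewrite lee_pdivlMr// (sqn_gt0 H).
Qed.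

(** The energy is a bounded quadratic form, and its trace is at most
    |gamma|^2 |Omega|; hence [maximizer_exists] applies. *)
Lemma finite_measure_max : (leb Omega < +oo)%E ->
  exists2 f, f != 0 & (supL2 * (sq f)%:E <= energy Omega f)%E.
Proof.
move=> Ofin; have [K K0 EK] := energy_bound hgamma.
have lebfin : leb Omega \is a fin_num by rewrite ge0_fin_numE.
have supfin : (supL2 <= (K * fine (leb Omega))%:E)%E.
  apply: ge_ereal_sup => _ [f f0 <-]; rewrite le_quotient_L2//.
  by rewrite -EFinM mulrAC EFinM fineK//; exact: EK.
pose s := fine supL2.
have supE : supL2 = s%:E.
  by rewrite fineK// ge0_fin_numE ?supL2_ge0// (le_lt_trans supfin)// ltry.
have s0 : 0 <= s by rewrite -lee_fin -supE supL2_ge0.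
have [s_eq0|s_neq0] := eqVneq s 0.
  by exists phi0 => //; rewrite supE s_eq0 mul0e energy_ge0.
have sp : 0 < s by rewrite lt_neqAle eq_sym s_neq0 s0.
have Efin f : energy Omega f \is a fin_num := energy_fin hgamma f mOmega Ofin.
pose q f := fine (energy Omega f).
have qE f : energy Omega f = (q f)%:E by rewrite fineK.
have gfin : hs_normsq gamma \is a fin_num.
  by rewrite ge0_fin_numE ?hs_normsq_ge0//; case: hgamma.
pose B := fine (hs_normsq gamma * leb Omega)%E.
have BE : (hs_normsq gamma * leb Omega)%E = B%:E by rewrite fineK// fin_numM.
have [f f0 qf] : exists2 f, f != 0 & q f = s * sq f.
  apply: (@maximizer_exists _ _ _ H q s B) => //.
  - by move=> f; rewrite fine_ge0// energy_ge0.
  - by move=> f g; exact: fine_energy_parallelogram.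
  - by move=> a f; rewrite /q energyZ// fineM.
  - by move=> f; rewrite -lee_fin -qE EFinM -supE; exact: energy_le_sup.
  - move=> e e0.
    have : ((s - e)%:E < supL2)%E by rewrite supE lte_fin ltrBlDr ltrDl.
    move=> /ereal_sup_gt[_ [f f0 <-]]; rewrite ltNge le_quotient_L2// -ltNge.
    by rewrite qE -EFinM lte_fin => fe; exists f.
  move=> t ut ton; rewrite -lee_fin -BE -sumEFin.
  under eq_bigr do rewrite -qE.
  exact: energy_trace.
by exists f => //; rewrite supE qE qf EFinM.
Qed.

Lemma phase_exhaustion : exists F : nat -> set Z,
  [/\ forall n, measurable (F n), forall n, (leb (F n) < +oo)%E,
    {homo F : m n / (m <= n)%N >-> m `<=` n} & \bigcup_n F n = setT].
Proof.
have /sigma_finiteP[G [TG ndG Goo]] := sigma_finiteT (lebesgue_tuple R d).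
exists (fun n => G n `*` G n); split.
- by move=> n; apply: measurableX; case: (Goo n).
- move=> n; have [mG Gfin] := Goo n.
  have -> : leb (G n `*` G n) =
      (lebesgue_tuple R d (G n) * lebesgue_tuple R d (G n))%E.
    exact: product_measure1E.
  by rewrite lte_mul_pinfty// ge0_fin_numE.
- move=> m n mn [x y] [/= Gx Gy].
  by have /subsetPset GG := ndG _ _ mn; split; exact: GG.
- apply/seteqP; split => // -[x y] _.
  have [k _ Gx] : (\bigcup_i G i) x by rewrite -TG.
  have [l _ Gy] : (\bigcup_i G i) y by rewrite -TG.
  exists (maxn k l) => //; split => /=.
    by have /subsetPset := ndG _ _ (leq_maxl k l); exact.
  by have /subsetPset := ndG _ _ (leq_maxr k l); exact.
Qed.

(** On regions of finite measure the energies are bounded quadratic forms. If the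
    supremum is infinite, they are not uniformly bounded, and uniform boundedness
    gives a function of infinite energy. *)
Lemma infinite_sup_attained : supL2 = +oo%E ->
  exists2 f, f != 0 & energy Omega f = +oo%E.
Proof.
move=> supy; have [F [mF Ffin ndF TF]] := phase_exhaustion.
pose E n := Omega `&` F n.
have mE n : measurable (E n) by exact: measurableI.
have Efin n : (leb (E n) < +oo)%E.
  apply: le_lt_trans (Ffin n); apply: le_measure; rewrite ?inE//.
  exact: subIsetr.
have enE n f : energy (E n) f \is a fin_num := energy_fin hgamma f (mE n) (Efin n).
have EO n f : (energy (E n) f <= energy Omega f)%E.
  apply: ge0_subset_integral => //.
  - exact: measurable_funTS (measurable_sq_stft hgamma f).
  - by move=> z _; rewrite lee_fin (sqn_ge0 H).
  - exact: subIsetl.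
have Ecvg f : (fun n => energy (E n) f) @ \oo --> energy Omega f.
  have -> : Omega = \bigcup_n E n by rewrite -setI_bigcupr TF setIT.
  apply: ge0_nondecreasing_set_cvg_integral => //.
  - by move=> m n mn; apply/subsetPset; apply: setIS; exact: ndF.
  - by move=> n; exact: measurable_funTS (measurable_sq_stft hgamma f).
  - by move=> n z _; rewrite lee_fin (sqn_ge0 H).
have /choice[K qK] n := energy_quadratic hgamma (mE n) (Efin n).
have [|f fM] := uniform_boundedness H qK.
  move=> M.
  have : ((M%:E) < supL2)%E by rewrite supy ltry.
  move=> /ereal_sup_gt[_ [f f0 <-]]; rewrite ltNge le_quotient_L2// -ltNge => Mf.
  exists f; apply: contrapT => /forallNP fN; move: Mf; apply/negP; rewrite -leNgt.
  rewrite -(cvg_lim _ (Ecvg f))//; apply: lime_le; first by apply/cvg_ex; exists (energy Omega f).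
  apply: nearW => n; rewrite -(fineK (enE n f)) -EFinM lee_fin leNgt.
  by apply/negP; exact: fN.
have fy : energy Omega f = +oo%E.
  apply/eqyP => A A0; have [n An] := fM A.
  apply: le_trans (EO n f); rewrite -(fineK (enE n f)) lee_fin; exact: ltW.
exists f => //; apply/eqP => f0; move: fy.
by rewrite f0 -(scale0r (0 : L2)) energyZ// abs20 mul0e.
Qed.

(** If the supremum [s] is finite, the nonnegative numbers
    s |rho e|^2 - energy (rho e) have sum zero, hence all vanish; any nonzero
    [rho e] is a maximizer. *)
Lemma attained_max rho : hilbert_schmidt rho -> rho != 0 ->
    quotient_HS gamma Omega rho = supHS ->
  exists2 f, f != 0 & (supL2 * (sq f)%:E <= energy Omega f)%E.
Proof.
move=> hrho rho0; rewrite sup_HS_L2.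
have [supy _|supfin] := eqVneq supL2 +oo%E.
  by have [f f0 fy] := infinite_sup_attained supy; exists f => //; rewrite fy leey.
pose s := fine supL2.
have supE : supL2 = s%:E.
  by rewrite fineK// ge0_fin_numE ?supL2_ge0// ltey.
have [r r0 rE] := hs_normsq_EFin hrho rho0.
have brho : bounded_linear rho by case: hrho.
have s0 : 0 <= s by rewrite -lee_fin -supE supL2_ge0.
rewrite quotient_HSE// supE => quot.
have sumE : (\esum_(e in onb) energy Omega (rho e) = (s * r)%:E)%E.
  rewrite EFinM -quot rE inver gt_eqF// -muleA -EFinM mulVf ?mule1//.
  by rewrite gt_eqF.
have Efin e : energy Omega (rho e) \is a fin_num.
  rewrite ge0_fin_numE ?energy_ge0//.
  apply: (le_lt_trans (energy_le_sup (rho e))).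
  by rewrite supE -EFinM ltry.
pose p e := s * sq (rho e) - fine (energy Omega (rho e)).
have pE e : (s * sq (rho e))%:E = ((p e)%:E + energy Omega (rho e))%E.
  by rewrite -[X in (_ + X)%E](fineK (Efin e)) -EFinD /p subrK.
have p0 e : 0 <= p e.
  rewrite subr_ge0 -lee_fin fineK// EFinM -supE; exact: energy_le_sup.
have psum : (\esum_(e in onb) (p e)%:E = 0)%E.
  have : (\esum_(e in onb) (sq (rho e) * s)%:E = (s * r)%:E)%E.
    rewrite esumZl//; last by move=> e; exact: (sqn_ge0 H).
    by rewrite -hs_normsqE rE -EFinM mulrC.
  under eq_esum do rewrite mulrC pE.
  rewrite esumD//; last 2 first.
  - by move=> e _; rewrite lee_fin.
  - by move=> e _; exact: energy_ge0.
  rewrite sumE; case: (\esum_(e in onb) (p e)%:E)%E => [x| |]// [] /eqP.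
  by rewrite -subr_eq0 addrK => /eqP ->.
have [e [oe re]] : exists e, onb e /\ rho e != 0.
  apply: contrapT => /forallNP ne; move/eqP: rho0; apply.
  apply/funext => f; apply: (bl_eq0 brho) => e oe.
  by apply/eqP/negPn/negP => re; exact: (ne e).
exists (rho e) => //.
have pe0 : ((p e)%:E <= 0)%E.
  rewrite -psum; apply: esum_ge; exists [set e]; last by rewrite fsbig_set1.
  by split => // _ ->.
by rewrite -EFinM pE -[leRHS]add0e leeD2r.
Qed.

End extremal_energy.

Theorem proposition3p1 (R : realType) (d : nat) (hd : (0 < d)%N)
    (gamma : L2 R d -> L2 R d) (Omega : set (Euclid R d * Euclid R d)%type)
    (hgamma : hilbert_schmidt gamma) (hgamma1 : hs_norm gamma = 1)
    (hOmega : measurable Omega) :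
  (* same eigenvalues *)
  (forall a : R[i],
     op_eigenvalue setT (locop_L2 gamma Omega) a <->
     op_eigenvalue hilbert_schmidt (locop_HS gamma Omega) a) /\
  (* infinite multiplicity on Hilbert-Schmidt operators *)
  (forall a : R[i],
     op_eigenvalue hilbert_schmidt (locop_HS gamma Omega) a ->
     forall n : nat,
       dim_ge (op_eigenspace hilbert_schmidt (locop_HS gamma Omega) a) n) /\
  (* eigenvectors have rank one unless the multiplicity on L^2 exceeds one *)
  (forall (a : R[i]) (rho : L2 R d -> L2 R d),
     op_eigenvector hilbert_schmidt (locop_HS gamma Omega) a rho ->
     ~ dim_ge (op_eigenspace setT (locop_L2 gamma Omega) a) 2 ->
     rank_one rho) /\
  (* equality of the suprema *)
  sup_quotient_HS gamma Omega = sup_quotient_L2 gamma Omega /\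
  (* the supremum is already the supremum over rank-one operators ... *)
  ereal_sup [set quotient_HS gamma Omega rho
            | rho in [set rho | hilbert_schmidt rho /\ rank_one rho]]
    = sup_quotient_HS gamma Omega /\
  (* ... and is attained at one of them as soon as it is attained at all, in
     particular when Omega has finite measure *)
  ((lebesgue_phase Omega < +oo)%E \/
   (exists rho, hilbert_schmidt rho /\ rho != 0 /\
      quotient_HS gamma Omega rho = sup_quotient_HS gamma Omega) ->
   exists rho, hilbert_schmidt rho /\ rank_one rho /\
      quotient_HS gamma Omega rho = sup_quotient_HS gamma Omega).
Proof.
have bgamma : bounded_linear gamma by case: hgamma.
split; first by move=> a; exact: same_eigenvalues.
split; first by move=> a; exact: infinite_multiplicity.
split; first by move=> a rho; exact: eigenvector_rank_one.
split; first exact: sup_HS_L2.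
split; first exact: sup_rank_one.
move=> attained.
suff [f f0 fmax] : exists2 f, f != 0 &
    (sup_quotient_L2 gamma Omega * (sqnorm (@dotL2 R d) f)%:E <= energy gamma Omega f)%E.
  have [rho [hrho rho1 rhomax]] := attained_rank_one hd hgamma hOmega f0 fmax.
  by exists rho.
case: attained => [Ofin|[rho [hrho [rho0 rhomax]]]].
  exact: finite_measure_max.
exact: (attained_max hd hgamma hOmega hrho rho0 rhomax).
Qed.
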